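(* Let $\mathbf{k}\subseteq\mathbb{C}$ be a field, let $X$ be a Hoffman set, let $A$ and $\tilde A$ be the algebra and the unitary algebra generated by $X$, and let $\lambda\in\mathbf{k}$. (1) The algebra product of $\gamma^+(\mathrm{Sh}^+(\mathbf{k}))$ and $\mathrm{Sh}^+(A)$ in $(\mathrm{Sh}^+(\tilde A),\diamond^+)$ has a Hopf algebra structure that expands the Hopf algebra structures on $\gamma^+(\mathrm{Sh}^+(\mathbf{k}))$ and on $\mathrm{Sh}^+(A)$ (i.e. both are Hopf subalgebras with their given structures). (2) The algebra product of $\gamma(\mathrm{Sh}(\mathbf{k}))$ and $\mathbf{1}_A\otimes\mathrm{Sh}^+(A)$ in $(\mathrm{Sh}(\tilde A),\diamond)$ has a Hopf algebra structure that expands the Hopf algebra structures on $\gamma(\mathrm{Sh}(\mathbf{k}))$ and on $\mathbf{1}_A\otimes\mathrm{Sh}^+(A)$.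
   Context: Hoffman set: a locally finite set $X=\bigsqcup_{n\ge1}X_n$ (each $X_n$ finite; elements of $X_n$ have degree $n$) together with a pairing $[\cdot,\cdot]:\bar X\times\bar X\to\bar X$, $\bar X=X\cup\{0\}$, such that: (S0) $[a,0]=0$ for all $a\in\bar X$; (S1) $[a,b]=[b,a]$; (S2) $[[a,b],c]=[a,[b,c]]$ for all $a,b,c\in\bar X$; (S3) either $[a,b]=0$ for all $a,b$, or $\deg([a,b])=\deg(a)+\deg(b)$ for all $a,b\in X$ (in particular $[a,b]\in X$). Algebras generated by $X$: $A=\mathbf{k}\{X\}$ is the free $\mathbf{k}$-module on $X$ with multiplication the $\mathbf{k}$-bilinear extension of $[\cdot,\cdot]$ (with $0\in\bar X$ read as $0\in A$); it is a commutative, not necessarily unital, $\mathbf{k}$-algebra. $\tilde A=\mathbf{k}\oplus A$ is its unitarization, with identity denoted $\mathbf{1}_A=(1_{\mathbf{k}},0)$. Mixable shuffle product of weight $\lambda\in\mathbf{k}$ on a commutative (not necessarily unital) $\mathbf{k}$-algebra $B$: for $m,n\ge1$ let $S(m,n)$ be the set of $\sigma\in S_{m+n}$ with $\sigma^{-1}(1)<\cdots<\sigma^{-1}(m)$ and $\sigma^{-1}(m+1)<\cdots<\sigma^{-1}(m+n)$. For $\sigma\in S(m,n)$ a pair $(k,k+1)$, $1\le k<m+n$, is admissible if $\sigma(k)\le m<\sigma(k+1)$; $\mathcal{T}^\sigma$ is the set of admissible pairs. For $a=a_1\otimes\cdots\otimes a_m$, $b=b_1\otimes\cdots\otimes b_n$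 and $T\subseteq\mathcal{T}^\sigma$, put $u_k=a_k$ for $k\le m$, $u_k=b_{k-m}$ for $k>m$, and let $\sigma(a\otimes b;T)\in B^{\otimes(m+n-|T|)}$ be obtained from $u_{\sigma(1)}\otimes\cdots\otimes u_{\sigma(m+n)}$ by replacing, for each $(k,k+1)\in T$, $u_{\sigma(k)}\otimes u_{\sigma(k+1)}$ by the product $u_{\sigma(k)}u_{\sigma(k+1)}$ in $B$. Then $a\diamond^+ b=\sum_{\sigma\in S(m,n)}\sum_{T\subseteq\mathcal{T}^\sigma}\lambda^{|T|}\sigma(a\otimes b;T)$. With scalars acting by scalar multiplication, this makes $\mathrm{Sh}^+(B):=\bigoplus_{k\ge0}B^{\otimes k}$ ($B^{\otimes0}=\mathbf{k}$) a commutative associative $\mathbf{k}$-algebra with identity $\mathbf{1}\in\mathbf{k}=B^{\otimes 0}$. If $B$ is unital, $\mathrm{Sh}(B):=B\otimes\mathrm{Sh}^+(B)$ is the tensor product algebra, with product $(a_0\otimes a)\diamond(b_0\otimes b)=(a_0b_0)\otimes(a\diamond^+b)$. $\mathrm{Sh}^+(A)$ is a subalgebra of $\mathrm{Sh}^+(\tilde A)$ via $A\hookrightarrow\tilde A$, and $\mathbf{1}_A\otimes\mathrm{Sh}^+(A)=\{\mathbf{1}_A\otimes a: a\in \mathrm{Sh}^+(A)\}\subseteq\mathrm{Sh}(\tilde A)$. Maps from $\mathbf{k}$: $\mathrm{Sh}^+(\mathbf{k})=\bigoplus_{n\ge0}\mathbf{k}\,\mathbf{1}_{\mathbf{k}}^{\otimes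 n}$ and $\mathrm{Sh}(\mathbf{k})=\bigoplus_{n\ge0}\mathbf{k}\,(\mathbf{1}_{\mathbf{k}}\otimes\mathbf{1}_{\mathbf{k}}^{\otimes n})$ (with $\mathbf{1}_{\mathbf{k}}^{\otimes0}=\mathbf{1}$). The algebra homomorphisms $\gamma^+:\mathrm{Sh}^+(\mathbf{k})\to\mathrm{Sh}^+(\tilde A)$ and $\gamma:\mathrm{Sh}(\mathbf{k})\to\mathrm{Sh}(\tilde A)$ are the $\mathbf{k}$-linear maps with $\gamma^+(\mathbf{1}_{\mathbf{k}}^{\otimes n})=\mathbf{1}_A^{\otimes n}$ and $\gamma(\mathbf{1}_{\mathbf{k}}\otimes\mathbf{1}_{\mathbf{k}}^{\otimes n})=\mathbf{1}_A\otimes\mathbf{1}_A^{\otimes n}$, $n\ge0$; both are injective. The algebra product of two subalgebras $U,V$ of a commutative algebra is the linear span of all products $uv$, $u\in U$, $v\in V$ (a subalgebra). Given Hopf structures. (i) On $\gamma^+(\mathrm{Sh}^+(\mathbf{k}))$, with basis $e_n=\mathbf{1}_A^{\otimes n}$, and on $\gamma(\mathrm{Sh}(\mathbf{k}))$, with basis $e_n=\mathbf{1}_A\otimes\mathbf{1}_A^{\otimes n}$, $n\ge 0$ (Andrews–Guo–Keigher–Ono): $\Delta(e_n)=\sum_{k=0}^n\sum_{i=0}^{n-k}(-\lambda)^k e_i\otimes e_{n-k-i}$, $\varepsilon(e_0)=1$, $\varepsilon(e_1)=\lambda$, $\varepsilon(e_n)=0$ for $n\ge2$. (ii) On $\mathrm{Sh}^+(A)$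 (and on $\mathbf{1}_A\otimes\mathrm{Sh}^+(A)$ via the algebra isomorphism $a\mapsto\mathbf{1}_A\otimes a$), with basis the tensors $x_1\otimes\cdots\otimes x_n$ of letters $x_i\in X$, $n\ge0$: the deconcatenation coproduct $\Delta(x_1\otimes\cdots\otimes x_n)=\sum_{i=0}^n (x_1\otimes\cdots\otimes x_i)\boxtimes(x_{i+1}\otimes\cdots\otimes x_n)$ (here $\boxtimes$ is the tensor product of two elements of $\mathrm{Sh}^+(A)$, and empty tensors are $\mathbf{1}$) and counit $\varepsilon(\mathbf{1})=1$, $\varepsilon(x_1\otimes\cdots\otimes x_n)=0$ for $n\ge1$. The antipodes are determined by these data. *)

(* Defs.v *)
From HB Require Import structures.
From mathcomp Require Import all_boot all_order all_algebra all_fingroup.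
From mathcomp Require Import boolp classical_sets cardinality reals.
From mathcomp Require Import finmap monalg complex.
From mathcomp Require Import generic_quotient ring_quotient.

Set Implicit Arguments.
Unset Strict Implicit.
Unset Printing Implicit Defensive.

Import GRing.Theory.
Local Open Scope classical_set_scope.
Local Open Scope quotient_scope.
Local Open Scope ring_scope.

Notation is_bilinear f := (bilinear_for *:%R *:%R f).

Fact scaler_swap (k : fieldType) (Z : lmodType k) (c d : k) (z1 z2 z3 z4 : Z) :
  c *: (d *: z1 + z3) + (d *: z2 + z4) = d *: (c *: z1 + z2) + (c *: z3 + z4).
Proof. by rewrite !scalerDr !scalerA [d * c]mulrC addrACA. Qed.

Section Span.
Context {k : fieldType} {V : lmodType k}.
Implicit Type G : set V.

Definition span G : {pred V} := fun x =>
  `[< exists n (c : 'I_n -> k) (v : 'I_n -> V),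
        (forall i, G (v i)) /\ x = \sum_i c i *: v i >].

Lemma mem_span G x : G x -> x \in span G.
Proof.
move=> Gx; apply/asboolP; exists 1%N, (fun=> 1), (fun=> x).
by split=> //; rewrite big_ord1 scale1r.
Qed.

Lemma span_submod_closed G : submod_closed (span G).
Proof.
split; first by apply/asboolP; exists 0%N, (fun=> 0), (fun=> 0);
  split; [case | rewrite big_ord0].
move=> a x y /asboolP[n [c [v [Gv ->]]]] /asboolP[m [d [w [Gw ->]]]].
apply/asboolP; exists (n + m)%N.
exists (fun i => match fintype.split i with inl j => a * c j | inr j => d j end).
exists (fun i => match fintype.split i with inl j => v j | inr j => w j end).
split; first by move=> i; case: fintype.split.
rewrite big_split_ord scaler_sumr; congr (_ + _); apply: eq_bigr => i _.
  case: fintype.splitP => j /= ij.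
    by rewrite scalerA (val_inj ij : i = j).
  by have := ltn_ord i; rewrite ij ltnNge leq_addr.
case: fintype.splitP => j /= ij.
  by have := ltn_ord j; rewrite -ij ltnNge leq_addr.
by rewrite (val_inj (addnI ij) : i = j).
Qed.

HB.instance Definition _ G :=
  GRing.isSubmodClosed.Build k V (span G) (span_submod_closed G).

Lemma span_ind G (P : V -> Prop) : P 0 ->
  (forall c x y, G x -> P y -> P (c *: x + y)) ->
  forall x, x \in span G -> P x.
Proof.
move=> P0 PD x /asboolP[n [c [v [Gv ->]]]].
elim: n c v Gv => [|n IH] c v Gv; first by rewrite big_ord0.
by rewrite big_ord_recl; apply: PD => //; apply: IH => i; apply: Gv.
Qed.

Definition span_of G := {x : V | x \in span G}.
HB.instance Definition _ G := SubChoice.on (span_of G).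
HB.instance Definition _ G := [SubChoice_isSubLmodule of span_of G by <:].

End Span.

(* The vector space generated by a set [K] subject to a set [R] of relations: *)
(* the quotient of the free vector space {malg k[K]} by the span of [R]       *)

Section Presented.
Context {k : fieldType} {K : choiceType}.

Definition linext (Z : lmodType k) (f : K -> Z) (x : {malg k[K]}) : Z :=
  \sum_(u <- msupp x) x@_u *: f u.

Lemma linext_linear (Z : lmodType k) (f : K -> Z) : linear (linext f).
Proof.
have E (D : {fset K}) x : (msupp x `<=` D)%fset ->
    linext f x = \sum_(u <- D) x@_u *: f u.
  move=> xD; rewrite /linext; apply: big_fset_incl => // u _ /mcoeff_outdom ->.
  by rewrite scale0r.
move=> a x y; pose D := (msupp x `|` msupp y `|` msupp (a *: x + y))%fset.
rewrite !(E D) ?fsubsetUr //; last 2 first.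
- by apply: fsubset_trans (fsubsetUl _ _); apply: fsubsetUr.
- by apply: fsubset_trans (fsubsetUl _ _); apply: fsubsetUl.
rewrite scaler_sumr -big_split; apply: eq_bigr => u _ /=.
by rewrite mcoeffD mcoeffZ scalerDl scalerA.
Qed.

Lemma linextU (Z : lmodType k) (f : K -> Z) u : linext f << u >> = f u.
Proof.
rewrite /linext msuppU oner_eq0 big_seq_fset1 mcoeffUU.
by rewrite scale1r.
Qed.

Lemma linext_eq (Z : lmodType k) (f g : {malg k[K]} -> Z) :
  linear f -> linear g -> (forall u, f << u >> = g << u >>) -> f =1 g.
Proof.
move=> fl gl fg x.
pose F : {linear {malg k[K]} -> Z} := HB.pack f (GRing.isLinear.Build _ _ _ _ f fl).
pose H : {linear {malg k[K]} -> Z} := HB.pack g (GRing.isLinear.Build _ _ _ _ g gl).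
rewrite -[f]/(F : _ -> _) -[g]/(H : _ -> _) (monalgE x) !linear_sum.
apply: eq_bigr => u _.
have -> : << x@_u *g u >> = x@_u *: << u >>.
  by apply/malgP => v; rewrite mcoeffZ !mcoeffU mulrnAr mulr1.
by rewrite !linearZ; congr (_ *: _); exact: fg.
Qed.

Variable R : set {malg k[K]}.

Definition presented := Quotient.quot (span R).
HB.instance Definition _ := GRing.Zmodule.on presented.

Definition pproj (x : {malg k[K]}) : presented := \pi_(Quotient.quot (span R)) x.
Definition prepr (x : presented) : {malg k[K]} :=
  @repr _ (Quotient.quot (span R)) x.

Lemma preprK x : pproj (prepr x) = x.
Proof. exact: reprK. Qed.

Lemma pprojB x y : pproj (x - y) = pproj x - pproj y.
Proof. exact: (@raddfB _ _ (\pi_(Quotient.quot (span R)))). Qed.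

Lemma pprojD x y : pproj (x + y) = pproj x + pproj y.
Proof. exact: (@raddfD _ _ (\pi_(Quotient.quot (span R)))). Qed.

Lemma pproj_eq0 x : (pproj x == 0) = (x \in span R).
Proof.
have {1}<- : pproj 0 = 0 by have /= := pprojB 0 0; rewrite !subrr.
have /= := Quotient.idealrBE (span R) x 0; rewrite subr0 => ->.
by [].
Qed.

Definition pscale (a : k) (x : presented) : presented := pproj (a *: prepr x).

Lemma pprojZ a x : pproj (a *: x) = pscale a (pproj x).
Proof.
apply/eqP; rewrite /pscale -subr_eq0 -pprojB pproj_eq0 -scalerBr rpredZ //.
by rewrite -pproj_eq0 pprojB preprK subrr.
Qed.

Fact pscaleA a b x : pscale a (pscale b x) = pscale (a * b) x.
Proof. by rewrite -[x]preprK -!pprojZ scalerA. Qed.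
Fact pscale1 : left_id 1 pscale.
Proof. by move=> x; rewrite -[x]preprK -pprojZ scale1r. Qed.
Fact pscaleDr : right_distributive pscale +%R.
Proof.
move=> a x y; rewrite -[x]preprK -[y]preprK -pprojD -!pprojZ -pprojD.
by rewrite scalerDr.
Qed.
Fact pscaleDl x : {morph pscale^~ x : a b / a + b}.
Proof. by move=> a b; rewrite -[x]preprK -!pprojZ -pprojD scalerDl. Qed.

HB.instance Definition _ := GRing.Zmodule_isLmodule.Build k presented
  pscaleA pscale1 pscaleDr pscaleDl.

Lemma pprojP a x y : pproj (a *: x + y) = a *: pproj x + pproj y.
Proof. by rewrite pprojD pprojZ. Qed.

Definition pgen (u : K) : presented := pproj << u >>.

(* The linear map out of [presented] sending [pgen u] to [f u]; only          *)
(* meaningful when [f] respects the relations.                                *)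
Definition plift (Z : lmodType k) (f : K -> Z) (x : presented) : Z :=
  linext f (prepr x).

Section Lift.
Variables (Z : lmodType k) (f : K -> Z).
Hypothesis fR : forall r, R r -> linext f r = 0.

Let F : {linear {malg k[K]} -> Z} :=
  HB.pack (linext f) (GRing.isLinear.Build _ _ _ _ _ (linext_linear f)).

Lemma plift_proj x : plift f (pproj x) = linext f x.
Proof.
apply/eqP; rewrite -subr_eq0 /plift -[linext f]/(F : _ -> _) -linearB.
have : prepr (pproj x) - x \in span R by rewrite -pproj_eq0 pprojB preprK subrr.
move: (_ - _); apply: span_ind => [|c y z /fR fy /eqP fz].
  by rewrite linear0.
by rewrite linearP /= fy scaler0 add0r; apply/eqP.
Qed.

Lemma plift_gen u : plift f (pgen u) = f u.
Proof. by rewrite plift_proj linextU. Qed.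

Lemma plift_linear : linear (plift f).
Proof.
move=> a x y; rewrite -[x]preprK -[y]preprK -[a *: _]pprojZ -pprojD.
by rewrite !plift_proj linext_linear.
Qed.

End Lift.

Lemma plift_eq (Z : lmodType k) (f g : presented -> Z) :
  linear f -> linear g -> (forall u, f (pgen u) = g (pgen u)) -> f =1 g.
Proof.
move=> fl gl fg x; rewrite -[x]preprK.
apply: (@linext_eq _ (f \o pproj) (g \o pproj)) => //= a y z /=.
  by rewrite pprojD pprojZ fl.
by rewrite pprojD pprojZ gl.
Qed.

End Presented.

Section Tensor.
Context {k : fieldType}.
Implicit Types U V W Z : lmodType k.

Definition tensor_rel V W : set {malg k[(V * W)%type]} := [set r |
  (exists c v1 v2 w,
     r = << (c *: v1 + v2, w) >> - (c *: << (v1, w) >> + << (v2, w) >>)) \/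
  (exists c v w1 w2,
     r = << (v, c *: w1 + w2) >> - (c *: << (v, w1) >> + << (v, w2) >>))].

Definition tensor V W : lmodType k := presented (@tensor_rel V W).

Definition tens {V W} (v : V) (w : W) : tensor V W := pgen _ (v, w).

(* The linear map sending [tens v w] to [f v w]; only meaningful for          *)
(* bilinear [f].                                                              *)
Definition tlift {V W Z} (f : V -> W -> Z) : tensor V W -> Z :=
  plift (fun p => f p.1 p.2).

Lemma tens_bilinear V W : is_bilinear (@tens V W).
Proof.
split=> [w c v1 v2|v c w1 w2]; apply/eqP; rewrite -subr_eq0 /tens /pgen;
  rewrite -pprojP -pprojB pproj_eq0 mem_span //=; [left|right].
  by exists c, v1, v2, w.
by exists c, v, w1, w2.
Qed.

Section Lift.
Variables (V W Z : lmodType k) (f : V -> W -> Z).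
Hypothesis f_bilinear : is_bilinear f.

Lemma tlift_rel r : tensor_rel r -> linext (fun p => f p.1 p.2) r = 0.
Proof.
have L := linext_linear (fun p => f p.1 p.2).
have LD x y : linext (fun p => f p.1 p.2) (x + y) =
    linext (fun p => f p.1 p.2) x + linext (fun p => f p.1 p.2) y.
  by rewrite -[x]scale1r L !scale1r.
have LB x y : linext (fun p => f p.1 p.2) (x - y) =
    linext (fun p => f p.1 p.2) x - linext (fun p => f p.1 p.2) y.
  by apply/eqP; rewrite eq_sym subr_eq -LD subrK.
case=> [[c [v1 [v2 [w ->]]]]|[c [v [w1 [w2 ->]]]]].
  by rewrite LB L !linextU /= (f_bilinear.1 w) subrr.
by rewrite LB L !linextU /= (f_bilinear.2 v) subrr.
Qed.

Lemma tlift_tens v w : tlift f (tens v w) = f v w.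
Proof. exact: (plift_gen tlift_rel). Qed.

Lemma tlift_linear : linear (tlift f).
Proof. exact: (plift_linear tlift_rel). Qed.

End Lift.

Definition tmap {V V' W W'} (f : V -> V') (g : W -> W') :
    tensor V W -> tensor V' W' :=
  tlift (fun v w => tens (f v) (g w)).

Definition tassoc {U V W} :
    tensor (tensor U V) W -> tensor U (tensor V W) :=
  tlift (fun x w => tlift (fun u v => tens u (tens v w)) x).

(* (v ⊗ w) (v' ⊗ w') = (v v') ⊗ (w w') *)
Definition tmul {V W} (mV : V -> V -> V) (mW : W -> W -> W)
    (x y : tensor V W) : tensor V W :=
  tlift (fun v w => tlift (fun v' w' => tens (mV v v') (mW w w')) y) x.

(* Finite sums of tensors of an element of [A] and an element of [B] *)
Definition tensor_set {V W} (A : set V) (B : set W) : set (tensor V W) :=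
  [set` span [set tens a b | a in A & b in B]].

End Tensor.

Notation "v \ox w" := (tens v w) (at level 40, left associativity).

(* The direct sum of the tensor powers V^{⊗n}, n >= 0: generated by the pure  *)
(* tensors v_1 ⊗ ... ⊗ v_n, written [pten [:: v_1; ...; v_n]], subject to     *)
(* linearity in each slot. All relations are homogeneous in n; V^{⊗0} is      *)
(* the line spanned by the empty tensor [pten [::]].                          *)

Section TensorPowers.
Context {k : fieldType}.
Implicit Types V W Z : lmodType k.

Definition tpow_rel V : set {malg k[seq V]} := [set r |
  exists c x y s t, r = << s ++ (c *: x + y) :: t >> -
    (c *: << s ++ x :: t >> + << s ++ y :: t >>)].

Definition tpow V : lmodType k := presented (@tpow_rel V).

Definition pten {V} (s : seq V) : tpow V := pgen _ s.

Definition multilinear {V Z} (f : seq V -> Z) : Prop :=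
  forall s t, linear (fun x => f (s ++ x :: t)).

Lemma pten_multilinear V : multilinear (@pten V).
Proof.
move=> s t c x y; apply/eqP; rewrite -subr_eq0 /pten /pgen.
rewrite -pprojP -pprojB pproj_eq0 mem_span //=.
by exists c, x, y, s, t.
Qed.

(* The linear map sending [pten s] to [f s]; only meaningful for multilinear  *)
(* [f].                                                                       *)
Definition tplift {V Z} (f : seq V -> Z) : tpow V -> Z := plift f.

Section Lift.
Variables (V Z : lmodType k) (f : seq V -> Z).
Hypothesis f_multilinear : multilinear f.

Lemma tplift_rel r : tpow_rel r -> linext f r = 0.
Proof.
have L := linext_linear f.
have LD x y : linext f (x + y) = linext f x + linext f y.
  by rewrite -[x]scale1r L !scale1r.
have LB x y : linext f (x - y) = linext f x - linext f y.
  by apply/eqP; rewrite eq_sym subr_eq -LD subrK.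
case=> [c [x [y [s [t ->]]]]].
by rewrite LB L !linextU /= f_multilinear subrr.
Qed.

Lemma tplift_pten s : tplift f (pten s) = f s.
Proof. exact: (plift_gen tplift_rel). Qed.

Lemma tplift_linear : linear (tplift f).
Proof. exact: (plift_linear tplift_rel). Qed.

End Lift.

(* The map induced by a linear map [f : V -> W] on each tensor power *)
Definition tpmap {V W} (f : V -> W) : tpow V -> tpow W :=
  tplift (fun s => pten (map f s)).

Lemma tpmap_pten V W (f : V -> W) s : linear f ->
  tpmap f (pten s) = pten (map f s).
Proof.
move=> fl; apply: tplift_pten => {}s t c x y.
by rewrite !map_cat /= fl pten_multilinear.
Qed.

End TensorPowers.

Record comNuAlg (k : fieldType) := ComNuAlg {
  nusort :> lmodType k;
  numul : nusort -> nusort -> nusort;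
  numul_bilinear : is_bilinear numul;
  numulC : commutative numul;
  numulA : associative numul
}.

(* Mixable shuffle product of weight [lam] on Sh^+(B) = tpow B                *)
(* Positions and indices are numbered from 0.                                 *)

Section MixableShuffle.
Context {k : fieldType}.

Definition is_shuffle m n (s : 'S_(m + n)) : bool :=
  [forall i : 'I_(m + n), forall j : 'I_(m + n),
     (i < j)%N && ((j < m)%N || (m <= i)%N) ==> ((s^-1)%g i < (s^-1)%g j)%N].

(* The pair (i, i+1) is represented by its first component i *)
Definition admissible m n (s : 'S_(m + n)) : {set 'I_(m + n)} :=
  [set i : 'I_(m + n) | [exists j : 'I_(m + n),
     [&& j == i.+1 :> nat, (s i < m)%N & (m <= s j)%N]]]%SET.

Variables (B : comNuAlg k) (lam : k).
Local Notation "x *_B y" := (@numul k B x y)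
  (at level 40, left associativity, only parsing).

(* Replaces v_i ⊗ v_{i+1} by v_i v_{i+1} whenever [J i] holds *)
Definition contract (J : pred nat) (v : seq B) : seq B :=
  [seq if J i then v`_i *_B v`_i.+1 else v`_i
     | i <- iota 0 (size v) & ~~ ((0 < i)%N && J i.-1)].

(* σ(a ⊗ b; T), where [u] is the concatenation of [a] and [b] *)
Definition shuffle_term N (u : seq B) (s : 'S_N) (T : {set 'I_N}) : tpow B :=
  pten (contract (fun i => [exists t in T, t == i :> nat])
                 [seq u`_(s i) | i <- enum 'I_N]).

Definition mixable_shuffle m n (u : seq B) : tpow B :=
  \sum_(s : 'S_(m + n) | is_shuffle s)
    \sum_(T : {set 'I_(m + n)} | T \subset admissible s)
      lam ^+ #|T| *: shuffle_term u s T.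

(* Bilinear extension; when [a] or [b] is empty, the only shuffle is the      *)
(* identity and the formula gives scalar multiplication.                      *)
Definition shp (x y : tpow B) : tpow B :=
  tplift (fun a =>
    tplift (fun b => mixable_shuffle (size a) (size b) (a ++ b)) y) x.

(* [shp] is well defined. *)

Lemma shuffle_term_multilinear m n (s : 'S_(m + n)) (T : {set 'I_(m + n)}) u1 u2 :
  (size u1 + (size u2).+1 = m + n)%N -> T \subset admissible s ->
  linear (fun x => shuffle_term (u1 ++ x :: u2) s T).
Proof.
move=> szu Tadm; rewrite /shuffle_term.
set J := fun i : nat => _.
have JP i : J i -> exists t : 'I_(m + n),
    exists t' : 'I_(m + n), [/\ t = i :> nat, t' = i.+1 :> nat,
      (s t < m)%N & (m <= s t')%N].
  case/exists_inP => t tT /eqP ti; have := fintype.subsetP Tadm t tT.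
  rewrite inE => /existsP[t' /and3P[/eqP t't lt le]].
  by exists t, t'; split; rewrite // t't ti.
have JJ i : J i -> ~~ J i.+1.
  move=> /JP[_ [t [_ ti _ le]]]; apply/negP => /JP[t' [_ [t'i _ lt _]]].
  have E : t = t' by apply: val_inj; rewrite /= ti t'i.
  by move: lt; rewrite -E ltnNge le.
have pN : (size u1 < m + n)%N by rewrite -szu addnS ltnS leq_addr.
set p := Ordinal pN; pose q : nat := (s^-1)%g p.
pose v x := [seq (u1 ++ x :: u2)`_(s i) | i <- enum 'I_(m + n)].
have szv x : size (v x) = (m + n)%N by rewrite size_map size_enum_ord.
have vE x i : (v x)`_i = if i == q then x else (v 0)`_i.
  have [iN|iN] := ltnP i (m + n); last first.
    rewrite !nth_default ?szv //; case: eqP => // iq.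
    by have := ltn_ord ((s^-1)%g p); rewrite -/q -iq ltnNge iN.
  have vi z : (v z)`_i = (u1 ++ z :: u2)`_(s (Ordinal iN)).
    rewrite (nth_map (Ordinal iN)) ?size_enum_ord //.
    by congr (_`_(s _)); apply/val_inj; rewrite /= nth_enum_ord.
  rewrite !vi !nth_cat; case: eqP => [iq|iq].
    have -> : s (Ordinal iN) = p.
      have -> : Ordinal iN = (s^-1)%g p by apply/val_inj.
      by rewrite permKV.
    by rewrite ltnn subnn.
  case: ltnP => // le; have : (s (Ordinal iN) != p).
    apply: contra_notN iq => /eqP E.
    by rewrite /q -E permK.
  rewrite -val_eqE /= => ne.
  have lt : (size u1 < s (Ordinal iN))%N by rewrite ltn_neqAle eq_sym ne.
  by rewrite -[(_ - _)%N]prednK ?subn_gt0.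
have qN : (q < m + n)%N by exact: ltn_ord.
have vq x : (v x)`_q = x by rewrite vE eqxx.
have vne x y i : i == q = false -> (v x)`_i = (v y)`_i.
  by move=> ne; rewrite vE ne [in RHS]vE ne.
pose L := [seq i <- iota 0 (m + n) | ~~ ((0 < i)%N && J i.-1)].
pose F x i := if J i then (v x)`_i *_B (v x)`_i.+1 else (v x)`_i.
have cE x : contract J (v x) = map (F x) L by rewrite /contract szv.
pose i0 := if (0 < q)%N && J q.-1 then q.-1 else q.
have i0L : i0 \in L.
  rewrite mem_filter mem_iota /= add0n /i0.
  case: ifP => [/andP[q0 Jq]|->]; last by rewrite qN.
  rewrite (leq_ltn_trans (leq_pred _) qN) andbT.
  apply/negP => /andP[q1 /JJ]; by rewrite prednK // Jq.
have Fne x i : i \in L -> i != i0 -> F x i = F 0 i.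
  rewrite mem_filter => /andP[iL _] ne; rewrite /F.
  have iq : i == q = false.
    by apply: contraNF ne => /eqP E; rewrite /i0 -E (negbTE iL).
  rewrite (vne x 0 i) //; case: ifP => // Ji; rewrite (vne x 0 i.+1) //.
  by apply: contraNF ne => /eqP E; rewrite /i0 -E /= Ji.
have Flin : linear (F^~ i0).
  have [Bl Br] := numul_bilinear B.
  move=> c x y; rewrite /i0; case: ifP => [/andP[q0 Jq]|_]; rewrite /F.
    rewrite Jq prednK // !vq; have ne : q.-1 == q = false.
      by apply/negbTE; rewrite -[X in _ != X]prednK // neq_ltn ltnSn.
    by rewrite (vne (c *: x + y) 0) // (vne x 0) // (vne y 0) // Br.
  rewrite !vq; case: ifP => // _.
  have ne : q.+1 == q = false by apply/negbTE; rewrite neq_ltn ltnSn orbT.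
  by rewrite (vne (c *: x + y) 0) // (vne x 0) // (vne y 0) // Bl.
have uL : uniq L by rewrite filter_uniq ?iota_uniq.
have [L1 [L2 LE]] : exists L1 L2, L = L1 ++ i0 :: L2.
  by case/splitPr: i0L => L1 L2; exists L1, L2.
have cF x : contract J (v x) = map (F 0) L1 ++ F x i0 :: map (F 0) L2.
  rewrite cE LE map_cat /=.
  move: uL; rewrite LE cat_uniq /= => /and4P[_ /norP[n1 _] n2 _].
  congr (_ ++ _ :: _); apply/eq_in_map => i iL; apply: Fne;
    rewrite ?LE ?mem_cat ?inE ?iL ?orbT //.
    by apply: contraNneq n1 => <-.
  by apply: contraNneq n2 => <-.
move=> c x y; rewrite -!/(v _) !cF Flin.
exact: pten_multilinear.
Qed.

Lemma mixable_shuffle_multilinear m n u1 u2 :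
  (size u1 + (size u2).+1 = m + n)%N ->
  linear (fun x => mixable_shuffle m n (u1 ++ x :: u2)).
Proof.
move=> szu c x y; rewrite scaler_sumr -big_split; apply: eq_bigr => s _.
rewrite scaler_sumr -big_split; apply: eq_bigr => T TA /=.
by rewrite shuffle_term_multilinear // scalerDr !scalerA mulrC.
Qed.

Lemma shp_pten_r a : multilinear (fun b =>
  mixable_shuffle (size a) (size b) (a ++ b)).
Proof.
move=> s t c x y; rewrite !size_cat /= !catA.
by rewrite mixable_shuffle_multilinear // size_cat addnA.
Qed.

Lemma shp_pten_l y : multilinear (fun a =>
  tplift (fun b => mixable_shuffle (size a) (size b) (a ++ b)) y).
Proof.
move=> s t c x x'.
pose f z y := tplift (fun b : seq B => mixable_shuffle
  (size (s ++ z :: t)) (size b) ((s ++ z :: t) ++ b)) y.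
have fl z : linear (f z) by apply: tplift_linear; apply: shp_pten_r.
rewrite -!/(f _ y); move: y; apply: plift_eq => [||b].
- exact: fl.
- by move=> d y y'; rewrite !fl; exact: scaler_swap.
- rewrite /f !tplift_pten; [|exact: shp_pten_r..].
  rewrite -!catA /= !size_cat /=.
  by rewrite mixable_shuffle_multilinear // size_cat -addnA addSn.
Qed.

Lemma shp_pten a b :
  shp (pten a) (pten b) = mixable_shuffle (size a) (size b) (a ++ b).
Proof.
rewrite /shp tplift_pten; last exact: shp_pten_l.
by rewrite tplift_pten //; apply: shp_pten_r.
Qed.

Lemma shp_bilinear : is_bilinear shp.
Proof.
split=> [y|x]; first by apply: tplift_linear; apply: shp_pten_l.
move=> c y y'; move: x; apply: plift_eq => [||a].
- by apply: tplift_linear; apply: shp_pten_l.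
- have L z : linear (shp^~ z) by apply: tplift_linear; apply: shp_pten_l.
  move=> d x x'; rewrite !L.
  exact: scaler_swap.
- rewrite /shp !tplift_pten; [|exact: shp_pten_l..].
  exact: (tplift_linear (@shp_pten_r a) c y y').
Qed.

(* Sh(B) = B ⊗ Sh^+(B), as an algebra; used for unital [B] *)
Definition Sh : lmodType k := tensor B (tpow B).

Definition shprod : Sh -> Sh -> Sh := tmul (@numul k B) shp.

End MixableShuffle.

(* Hoffman sets and the algebras they generate                                *)
(* The element 0 of X ∪ {0} is represented by [None].                         *)

Record hoffmanSet := HoffmanSet {
  letter :> choiceType;
  hdeg : letter -> nat;
  bracket : option letter -> option letter -> option letter;
  hdeg_gt0 : forall x, (0 < hdeg x)%N;
  hdeg_finite : forall n, finite_set [set x | hdeg x = n];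
  bracket0 : forall a, bracket a None = None;
  bracketC : forall a b, bracket a b = bracket b a;
  bracketA : forall a b c, bracket (bracket a b) c = bracket a (bracket b c);
  bracket_deg :
    (forall a b, bracket a b = None) \/
    (forall a b : letter, exists2 c,
       bracket (Some a) (Some b) = Some c & hdeg c = (hdeg a + hdeg b)%N)
}.

Section HoffmanAlgebra.
Variables (k : fieldType) (X : hoffmanSet).

Definition of_letter (a : option X) : {malg k[X]} := oapp (fun x => << x >>) 0 a.

Definition amul (f g : {malg k[X]}) : {malg k[X]} :=
  linext (fun x => linext (fun y => of_letter (bracket (Some x) (Some y))) g) f.

Lemma amul_bilinear : is_bilinear amul.
Proof.
have Bl g : linear (amul^~ g) by exact: linext_linear.
split=> [g|f]; first exact: Bl.
move=> c g g'; move: f.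
apply: linext_eq => [||x].
- exact: Bl.
- by move=> d f f'; rewrite !Bl; exact: scaler_swap.
- rewrite /amul !linextU; exact: linext_linear.
Qed.

Lemma amul_letter a b : amul (of_letter a) (of_letter b) = of_letter (bracket a b).
Proof.
have [Bl Br] := amul_bilinear.
have z0 g : amul 0 g = 0.
  by have /= := Bl g (-1) 0 0; rewrite scaler0 addr0 scaleN1r addNr.
have z1 f : amul f 0 = 0.
  by have /= := Br f (-1) 0 0; rewrite scaler0 addr0 scaleN1r addNr.
case: a => [a|] /=; last by rewrite z0 bracketC bracket0.
case: b => [b|] /=; last by rewrite z1 bracket0.
by rewrite /amul !linextU.
Qed.

Lemma amulC : commutative amul.
Proof.
have [Bl Br] := amul_bilinear.
move=> f g; move: f; apply: linext_eq => [||x]; [exact: Bl|exact: Br|].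
move: g; apply: linext_eq => [||y]; [exact: Br|exact: Bl|].
have := amul_letter (Some x) (Some y); rewrite /= => ->.
by have := amul_letter (Some y) (Some x); rewrite /= bracketC => ->.
Qed.

Lemma amulA : associative amul.
Proof.
have [Bl Br] := amul_bilinear.
move=> f g h; move: f; apply: linext_eq => [||x].
- exact: Bl.
- by move=> c f f'; rewrite !Bl.
move: g; apply: linext_eq => [||y].
- by move=> c g g'; rewrite Bl Br.
- by move=> c g g'; rewrite Br Bl.
move: h; apply: linext_eq => [||z].
- by move=> c h h'; rewrite !Br.
- exact: Br.
have E u : << u >> = of_letter (Some u) by [].
by rewrite !E !amul_letter bracketA.
Qed.

Definition algA : comNuAlg k := ComNuAlg amul_bilinear amulC amulA.

(* The unitarization k ⊕ A *)
Definition umul (x y : (k^o * algA)%type) : (k^o * algA)%type :=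
  (x.1 * y.1, x.1 *: y.2 + y.1 *: x.2 + amul x.2 y.2).

Lemma umul_bilinear : is_bilinear umul.
Proof.
have [Bl Br] := amul_bilinear.
split=> [[d h]|[d h]] c [a f] [b g]; rewrite /umul; congr (_, _) => /=.
- by rewrite mulrDl scalerAl.
- have -> : (c *: a + b : k) = c * a + b by [].
  rewrite Bl !scalerDr !scalerDl !scalerA [d * c]mulrC.
  by rewrite (AC (2*2*2) ((1*3*5)*(2*4*6))).
- by rewrite mulrDr scalerAr.
- have -> : (c *: a + b : k) = c * a + b by [].
  rewrite Br !scalerDr !scalerDl !scalerA [d * c]mulrC.
  by rewrite (AC (2*2*2) ((1*3*5)*(2*4*6))).
Qed.

Lemma umulC : commutative umul.
Proof.
move=> [a f] [b g].
apply: injective_projections => /=.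
  exact: (@mulrC k).
by rewrite [amul f g]amulC [a *: g + _]addrC.
Qed.

Lemma umulA : associative umul.
Proof.
have [Bl Br] := amul_bilinear.
have lD f g h : amul (f + g) h = amul f h + amul g h.
  by have /= := Bl h 1 f g; rewrite !scale1r.
have rD f g h : amul h (f + g) = amul h f + amul h g.
  by have /= := Br h 1 f g; rewrite !scale1r.
have l0 h : amul 0 h = 0.
  by have /= := Bl h (-1) 0 0; rewrite scaler0 addr0 scaleN1r addNr.
have r0 h : amul h 0 = 0.
  by have /= := Br h (-1) 0 0; rewrite scaler0 addr0 scaleN1r addNr.
have lZ c f h : amul (c *: f) h = c *: amul f h.
  by have /= := Bl h c f 0; rewrite !addr0 l0 addr0.
have rZ c f h : amul h (c *: f) = c *: amul h f.
  by have /= := Br h c f 0; rewrite !addr0 r0 addr0.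
move=> [a f] [b g] [c h]; apply: injective_projections => /=.
  exact: (@mulrA k).
rewrite !(lD, rD, lZ, rZ) !scalerDr !scalerA amulA.
rewrite [c * a]mulrC [c * b]mulrC.
by rewrite (AC (3*1*3) (1*(2*4*6)*(3*5*7))).
Qed.

Definition algU : comNuAlg k := ComNuAlg umul_bilinear umulC umulA.

Definition unitU : algU := (1, 0).

Lemma umul1 : left_id unitU umul.
Proof.
have [Bl _] := amul_bilinear.
move=> [a f]; rewrite /umul /= mul1r scale1r scaler0 addr0.
have /= := Bl f (-1) 0 0; rewrite scaler0 addr0 scaleN1r addNr => ->.
by rewrite addr0.
Qed.

Definition scalarU (c : k^o) : algU := (c, 0).
Definition inclU (a : algA) : algU := (0, a).

Lemma scalarU_linear : linear scalarU.
Proof. by move=> c x y; congr (_, _); rewrite /= scaler0 addr0. Qed.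

Lemma inclU_linear : linear inclU.
Proof. by move=> c x y; congr (_, _); rewrite /= scaler0 addr0. Qed.

(* γ^+ : Sh^+(k) -> Sh^+(Ã) and γ : Sh(k) = k ⊗ Sh^+(k) -> Sh(Ã) *)
Definition gammap : tpow k^o -> tpow algU := tpmap scalarU.
Definition gamma : tensor k^o (tpow k^o) -> Sh algU := tmap scalarU gammap.

(* Sh^+(A) -> Sh^+(Ã) and Sh^+(A) -> 1_A ⊗ Sh^+(A) *)
Definition inclp : tpow algA -> tpow algU := tpmap inclU.
Definition incl (a : tpow algA) : Sh algU := unitU \ox inclp a.

Definition unit_word n : tpow algU := pten (nseq n unitU).
Definition letter_word (w : seq X) : tpow algA :=
  pten [seq of_letter (Some x) | x <- w].

Lemma gammap_unit_word n : gammap (pten (nseq n 1)) = unit_word n.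
Proof. by rewrite /gammap tpmap_pten ?map_nseq //; apply: scalarU_linear. Qed.

Lemma gamma_unit_word n : gamma (1 \ox pten (nseq n 1)) = unitU \ox unit_word n.
Proof.
have gl : linear gammap.
  apply: tplift_linear => s t c x y.
  by rewrite !map_cat /= scalarU_linear pten_multilinear.
have [Tl Tr] := @tens_bilinear k algU (tpow algU).
rewrite /gamma /tmap tlift_tens ?gammap_unit_word //.
split=> [w c v1 v2|v c w1 w2]; first by rewrite scalarU_linear Tl.
by rewrite gl Tr.
Qed.

End HoffmanAlgebra.

Record hopfAlg (k : fieldType) (H : lmodType k) := HopfAlg {
  hpmul : H -> H -> H;
  hpone : H;
  hpcomul : H -> tensor H H;
  hpcounit : H -> k;
  hpanti : H -> H;
  hpmul_bilinear : is_bilinear hpmul;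
  hpmulA : associative hpmul;
  hpmul1l : left_id hpone hpmul;
  hpmul1r : right_id hpone hpmul;
  hpcomul_linear : linear hpcomul;
  hpcounit_linear : scalar hpcounit;
  hpanti_linear : linear hpanti;
  hpcomulA : forall x,
    tassoc (tmap hpcomul id (hpcomul x)) = tmap id hpcomul (hpcomul x);
  hpcounitl : forall x, tlift (fun y z => hpcounit y *: z) (hpcomul x) = x;
  hpcounitr : forall x, tlift (fun y z => hpcounit z *: y) (hpcomul x) = x;
  hpcomulM : forall x y,
    hpcomul (hpmul x y) = tmul hpmul hpmul (hpcomul x) (hpcomul y);
  hpcomul1 : hpcomul hpone = hpone \ox hpone;
  hpcounitM : forall x y, hpcounit (hpmul x y) = hpcounit x * hpcounit y;
  hpcounit1 : hpcounit hpone = 1;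
  hpantil : forall x,
    tlift (fun y z => hpmul (hpanti y) z) (hpcomul x) = hpcounit x *: hpone;
  hpantir : forall x,
    tlift (fun y z => hpmul y (hpanti z)) (hpcomul x) = hpcounit x *: hpone
}.

Section HopfProduct.
Context {k : fieldType}.

Record hopf_subalgebra {H : lmodType k} (h : hopfAlg H) (U : set H) : Prop := {
  hs_one : U (hpone h);
  hs_linear : forall c x y, U x -> U y -> U (c *: x + y);
  hs_mul : forall x y, U x -> U y -> U (hpmul h x y);
  hs_comul : forall x, U x -> tensor_set U U (hpcomul h x);
  hs_anti : forall x, U x -> U (hpanti h x)
}.

Definition agko_structure {H : lmodType k} (h : hopfAlg H) (lam : k)
    (e : nat -> H) : Prop :=
  (forall n, hpcomul h (e n) =
     \sum_(j < n.+1) \sum_(i < (n - j).+1)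
       (- lam) ^+ j *: (e i \ox e (n - j - i)%N)) /\
  (forall n, hpcounit h (e n) =
     if n is 0%N then 1 else if n is 1%N then lam else 0).

Definition deconcatenation_structure {H : lmodType k} (h : hopfAlg H)
    (X : Type) (w : seq X -> H) : Prop :=
  (forall s, hpcomul h (w s) =
     \sum_(i < (size s).+1) w (take i s) \ox w (drop i s)) /\
  (forall s, hpcounit h (w s) = if s is [::] then 1 else 0).

(* The algebra product of [U] and [V] in the algebra [P] with product [mul]   *)
Definition algprod {P : lmodType k} (mul : P -> P -> P) (U V : set P) :
    lmodType k :=
  span_of [set mul u v | u in U & v in V].

(* The algebra product of [U] and [V] has a Hopf algebra structure, with the  *)
(* product and unit of [P], for which [U] and [V] are Hopf subalgebras with   *)
(* the structures given on the basis [e] of [U] and the basis [w] of [V].     *)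
Definition algprod_hopf_expands {P : lmodType k} (mul : P -> P -> P) (one : P)
    (U V : set P) (lam : k) (e : nat -> P) (X : Type) (w : seq X -> P) : Prop :=
  exists h : hopfAlg (algprod mul U V),
    [/\ (forall x y, val (hpmul h x y) = mul (val x) (val y)) /\
          val (hpone h) = one,
        U `<=` range (val : algprod mul U V -> P) /\
          hopf_subalgebra h (val @^-1` U),
        V `<=` range (val : algprod mul U V -> P) /\
          hopf_subalgebra h (val @^-1` V),
        exists2 e', (forall n, val (e' n) = e n) & agko_structure h lam e'
      & exists2 w', (forall s, val (w' s) = w s) &
          deconcatenation_structure h w'].

End HopfProduct.

(* Main.v *)
From HB Require Import structures.
Require Import Defs.
From mathcomp Require Import all_boot all_order all_algebra all_fingroup.
From mathcomp Require Import monalg.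
From mathcomp Require Import boolp classical_sets reals complex.
Set Implicit Arguments.
Unset Strict Implicit.
Unset Printing Implicit Defensive.
Import GRing.Theory.
Local Open Scope classical_set_scope.
Local Open Scope ring_scope.

(** Write [Ã] for the unitarization of the algebra [A] of a Hoffman set and
    [f : Ã -> k] for the projection with kernel [A]; it is multiplicative. The
    theorem holds because the two given Hopf structures are restrictions of
    one and the same Hopf structure on all of [Sh^+(Ã)].

    For every commutative algebra [B], deconcatenation makes [Sh^+(B)] a Hopf
    algebra under the mixable shuffle product ([qshuffle_hopf]). All identities
    are proved by induction on words from the quasi-shuffle recursion
    [[
      au * bv = a (u * bv) + b (au * v) + lam (ab) (u * v),
    ]]
    which is extracted from the sum over shuffle permutations and merging sets
    in [mixable_shuffleE]. On [Sh^+(A)] this is the given structure, but on the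
    powers [e_n] of the unit it would give [sum_i e_i ⊗ e_(n-i)] only.

    Given a multiplicative functional [f] on [B], let [D] remove the first letter
    [a] of a word and multiply the rest by [f a]. The recursion shows that
    [1 + lam D] is multiplicative; it is an automorphism [twist] of the algebra
    [Sh^+(B)], and [Delta twist = (twist ⊗ id) Delta], since [D] acts on the left
    end of a word. For [B = Ã] and [f] as above, the structure pulled back along it ([twisted_hopf]) therefore has comultiplication
    [(id ⊗ twist^-1) Delta] and counit [epsilon twist]. Words in [A] are fixed by
    [twist], so nothing changes on [Sh^+(A)], while
    [twist^-1 e_n = sum_j (- lam)^j e_(n-j)], and the structure on the [e_n]
    becomes the Andrews-Guo-Keigher-Ono one ([twisted_agko]).

    Both subalgebras are images of maps [Sh^+(B') -> Sh^+(Ã)] induced by algebra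
    morphisms [B' -> Ã], which commute with all the structure, so they are Hopf
    subalgebras ([range_tpmap_hopf_subalgebra]). In a commutative Hopf algebra
    with multiplicative antipode, the product of two Hopf subalgebras is again
    one ([product_hopf_subalgebra]). Restricting the comultiplication to it means
    to lift tensors from [P ⊗ P] to [W ⊗ W]; a linear projection onto the subspace
    [W] does this ([exists_projection], [hopf_transport]).

    For the second part, [x |-> 1_A ⊗ x] is an injective algebra morphism
    [Sh^+(Ã) -> Sh(Ã)], with left inverse [f ⊗ id], and it carries the two
    subalgebras of the first part to those of the second. Both parts are thus
    instances of [algprod_hopf_expandsI]. *)

(** * Linear maps and projections onto subspaces *)

Section Linear.
Context {k : fieldType} {V W : lmodType k}.
Variable f : V -> W.
Hypothesis fl : linear f.

Lemma lin0 : f 0 = 0.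
Proof. by have := fl (-1) 0 0; rewrite scaler0 addr0 scaleN1r addNr. Qed.
Lemma linD x y : f (x + y) = f x + f y.
Proof. by have := fl 1 x y; rewrite !scale1r. Qed.
Lemma linZ c x : f (c *: x) = c *: f x.
Proof. by have := fl c x 0; rewrite !addr0 lin0 addr0. Qed.
Lemma linB x y : f (x - y) = f x - f y.
Proof. by rewrite linD -scaleN1r linZ scaleN1r. Qed.
Lemma lin_sum I (s : seq I) (p : pred I) F :
  f (\sum_(i <- s | p i) F i) = \sum_(i <- s | p i) f (F i).
Proof. exact: (big_morph f linD lin0). Qed.
End Linear.

Lemma lin_comb (k : fieldType) (V W : lmodType k) (f g : V -> W) (c : k) :
  linear f -> linear g -> linear (fun x => c *: f x + g x).
Proof. by move=> fl gl d x y; rewrite fl gl; exact: scaler_swap. Qed.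

Section LinearClosure.
Context {k : fieldType}.
Implicit Types U V W Z : lmodType k.

Lemma lin_id V : linear (fun x : V => x).
Proof. by []. Qed.
Lemma lin_comp U V W (f : V -> W) (g : U -> V) :
  linear f -> linear g -> linear (fun x => f (g x)).
Proof. by move=> fl gl c x y; rewrite gl fl. Qed.
Lemma lin_add V W (f g : V -> W) :
  linear f -> linear g -> linear (fun x => f x + g x).
Proof. by move=> fl gl c x y; rewrite fl gl scalerDr addrACA. Qed.
Lemma lin_scale V W (f : V -> W) c : linear f -> linear (fun x => c *: f x).
Proof. by move=> fl d x y; rewrite fl scalerDr !scalerA mulrC. Qed.

End LinearClosure.

Section Projection.
Context {k : fieldType} {V : lmodType k}.

(** Zorn's lemma gives a subspace maximal among those meeting [H] only in [0];
    maximality makes it a complement of [H]. *)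
Lemma exists_projection (H : set V) :
    H 0 -> (forall c x y, H x -> H y -> H (c *: x + y)) ->
  exists p : V -> V,
    [/\ linear p, forall x, H (p x) & forall x, H x -> p x = x].
Proof.
move=> H0 HP.
have HD x y : H x -> H y -> H (x + y) by move=> Hx /(HP 1 _ _ Hx); rewrite scale1r.
have HZ c x : H x -> H (c *: x) by move=> /(HP c x 0)/(_ H0); rewrite addr0.
(* The empty set is admitted in [indep], as the union of the empty chain. *)
pose indep (C : set V) := (forall c x y, C x -> C y -> C (c *: x + y)) /\
  (forall x, C x -> H x -> x = 0).
have [F FI Ftot|A [[AP AH] Amax]] := @Zorn_bigcup V indep.
  split=> [c x y [C FC Cx] [D FD Dy]|x [C FC Cx]]; last exact: (FI _ FC).2.
  have [CD|DC] := Ftot _ _ FC FD.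
    by exists D => //; apply: (FI _ FD).1 => //; apply: CD.
  by exists C => //; apply: (FI _ FC).1 => //; apply: DC.
have A0 : A 0.
  apply: contrapT => nA0; apply: (Amax [set 0]).
    split=> [|AE]; last by apply: nA0; apply: AE.
    move=> x Ax; case: nA0; have := AP (-1) x x Ax Ax.
    by rewrite scaleN1r addNr.
  by split=> [c x y -> -> /=|x ->//]; rewrite scaler0 addr0.
have AD x y : A x -> A y -> A (x + y) by move=> Ax /(AP 1 _ _ Ax); rewrite scale1r.
have AZ c x : A x -> A (c *: x) by move=> /(AP c x 0)/(_ A0); rewrite addr0.
have dec v : exists h, H h /\ A (v - h).
  apply: contrapT => nv.
  pose B := [set x | exists t a, A a /\ x = t *: v + a].
  apply: (Amax B).
    split=> [x Ax|BA]; first by exists 0, x; rewrite scale0r add0r.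
    apply: nv; exists 0; split=> //; rewrite subr0; apply: BA.
    by exists 1, 0; rewrite scale1r addr0.
  split=> [c _ _ [t [a [Aa ->]]] [u [b [Ab ->]]]|_ [t [a [Aa ->]]] Hx].
    exists (c * t + u), (c *: a + b); split; first exact: AP.
    by rewrite scalerDr scalerA scalerDl addrACA.
  have [t0|t0] := eqVneq t 0.
    by move: Hx; rewrite t0 scale0r add0r; apply: AH.
  case: nv; exists (t^-1 *: (t *: v + a)); split; first exact: HZ.
  rewrite scalerDr scalerA mulVf // scale1r opprD addNKr -scaleNr; exact: AZ.
have /choice[p pP] := dec.
have puniq v h : H h -> A (v - h) -> p v = h.
  move=> Hh Ah; apply/eqP; rewrite -subr_eq0; apply/eqP; apply: AH.
    have -> : p v - h = (-1) *: (v - p v) + (v - h).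
      by rewrite scaleN1r opprB addrA subrK.
    by apply: AP => //; apply: (pP v).2.
  by rewrite -scaleN1r addrC; apply: HP => //; apply: (pP v).1.
exists p; split=> [c x y|x|x Hx]; last 2 first.
- exact: (pP x).1.
- by apply: puniq => //; rewrite subrr.
apply: puniq; first by apply: HP; apply: (pP _).1.
rewrite opprD addrACA -scalerBr; apply: AP; exact: (pP _).2.
Qed.

End Projection.

(** * Maps between tensor products *)

Section TensorMaps.
Context {k : fieldType}.
Implicit Types U V W Z : lmodType k.

Lemma tensor_eq V W Z (f g : tensor V W -> Z) : linear f -> linear g ->
  (forall v w, f (v \ox w) = g (v \ox w)) -> f =1 g.
Proof. by move=> fl gl fg; apply: plift_eq => // -[v w]; exact: fg. Qed.

Lemma tensl V W (w : W) : linear (fun v : V => v \ox w).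
Proof. exact: (tens_bilinear V W).1. Qed.
Lemma tensr V W (v : V) : linear (fun w : W => v \ox w).
Proof. exact: (tens_bilinear V W).2. Qed.

Lemma tlift_comp V W Z Z' (F : V -> W -> Z) (g : Z -> Z') t :
  is_bilinear F -> linear g -> g (tlift F t) = tlift (fun v w => g (F v w)) t.
Proof.
move=> Fb gl.
have gFb : is_bilinear (fun v w => g (F v w)).
  by split=> [w|v] c x y; rewrite ?(Fb.1 w) ?(Fb.2 v) gl.
move: t; apply: tensor_eq => [c x y||v w].
- by rewrite tlift_linear // gl.
- exact: tlift_linear.
- by rewrite !tlift_tens.
Qed.

Section Tmap.
Variables (V V' W W' : lmodType k) (f : V -> V') (g : W -> W').
Hypotheses (fl : linear f) (gl : linear g).

Lemma tens_map_bilinear : is_bilinear (fun v w => f v \ox g w).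
Proof. by split=> [w|v] c x y; rewrite ?fl ?gl ?tensl ?tensr. Qed.

Lemma tmap_tens v w : tmap f g (v \ox w) = f v \ox g w.
Proof. exact: (tlift_tens tens_map_bilinear). Qed.

Lemma tmap_linear : linear (tmap f g).
Proof. exact: (tlift_linear tens_map_bilinear). Qed.

Lemma tlift_tmap Z (F : V' -> W' -> Z) t : is_bilinear F ->
  tlift F (tmap f g t) = tlift (fun v w => F (f v) (g w)) t.
Proof.
move=> Fb; rewrite /tmap tlift_comp; last 2 first.
- exact: tens_map_bilinear.
- exact: tlift_linear.
by congr (tlift _ t); apply/funext => v; apply/funext => w; rewrite tlift_tens.
Qed.

End Tmap.

Lemma tmap_comp V V' V'' W W' W'' (f : V' -> V'') (f' : V -> V')
    (g : W' -> W'') (g' : W -> W') t :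
    linear f -> linear f' -> linear g -> linear g' ->
  tmap f g (tmap f' g' t) = tmap (f \o f') (g \o g') t.
Proof.
move=> fl f'l gl g'l.
exact: (tlift_tmap f'l g'l t (tens_map_bilinear fl gl)).
Qed.

Lemma tmap_id V W (t : tensor V W) : tmap id id t = t.
Proof.
by move: t; apply: tensor_eq => [||v w] //; [exact: tmap_linear|rewrite tmap_tens].
Qed.

(** Stated for an abstract family [F], so that no proof has to compare two
    maps out of a tensor product after unfolding them. *)
Lemma tensor_family_bilinear U V W Z (F : W -> tensor U V -> Z) :
    (forall w, linear (F w)) -> (forall u v, linear (fun w => F w (u \ox v))) ->
  is_bilinear (fun x w => F w x).
Proof.
move=> Fl Fuv; split=> [w|x]; first exact: Fl.
move=> c w w'; move: x; apply: tensor_eq => [||u v]; last exact: Fuv.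
  exact: Fl.
exact: lin_comb.
Qed.

Lemma tassoc_inner_linear U V W (w : W) :
  linear (tlift (fun (u : U) (v : V) => u \ox (v \ox w))).
Proof.
by apply: tlift_linear; split=> [v|u] c x y; rewrite ?tensl ?tensr.
Qed.

Lemma tassoc_inner_bilinear U V W :
  is_bilinear (fun (x : tensor U V) (w : W) =>
    tlift (fun u v => u \ox (v \ox w)) x).
Proof.
apply: tensor_family_bilinear => [w|u v]; first exact: tassoc_inner_linear.
rewrite (_ : (fun w => _) = fun w => u \ox (v \ox w)).
  by move=> c x y; rewrite (tensr v) (tensr u).
apply/funext => w; apply: tlift_tens.
by split=> [v'|u'] c x y; rewrite ?tensl ?tensr.
Qed.

Lemma tassoc_linear U V W : linear (@tassoc k U V W).
Proof. exact: tlift_linear (tassoc_inner_bilinear _ _ _). Qed.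

Lemma tassoc_tens U V W (u : U) (v : V) (w : W) :
  tassoc ((u \ox v) \ox w) = u \ox (v \ox w).
Proof.
rewrite /tassoc tlift_tens; last exact: tassoc_inner_bilinear.
by rewrite tlift_tens //; split=> [v'|u'] c x y; rewrite ?tensl ?tensr.
Qed.

Lemma tensor3_eq U V W Z (f g : tensor (tensor U V) W -> Z) :
  linear f -> linear g ->
  (forall u v w, f ((u \ox v) \ox w) = g ((u \ox v) \ox w)) -> f =1 g.
Proof.
move=> fl gl fg; apply: tensor_eq => // t w; move: t.
by apply: tensor_eq => [c x y|c x y|u v]; rewrite ?tensl ?fl ?gl.
Qed.

Lemma tassoc_nat U V W U' V' W' (f : U -> U') (g : V -> V') (h : W -> W') t :
    linear f -> linear g -> linear h ->
  tassoc (tmap (tmap f g) h t) = tmap f (tmap g h) (tassoc t).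
Proof.
move=> fl gl hl; have fgl := tmap_linear fl gl; have ghl := tmap_linear gl hl.
move: t; apply: tensor3_eq => [c x y|c x y|u v w].
- rewrite (tmap_linear fgl hl). rewrite (@tassoc_linear U' V' W'). by [].
- rewrite (@tassoc_linear U V W). rewrite (tmap_linear fl ghl). by [].
- rewrite (tmap_tens fgl hl). rewrite (tmap_tens fl gl). rewrite !tassoc_tens.
  rewrite (tmap_tens fl ghl). rewrite (tmap_tens gl hl). by [].
Qed.

Lemma scale_bilinearl V W (e : V -> k) :
  scalar e -> is_bilinear (fun v (w : W) => e v *: w).
Proof.
move=> el; split=> [w|v] c x y; first by rewrite /= el scalerDl -scalerA.
by rewrite /= scalerDr !scalerA [e v * c]mulrC.
Qed.

Lemma scale_bilinearr V W (e : W -> k) :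
  scalar e -> is_bilinear (fun (v : V) w => e w *: v).
Proof.
move=> el; split=> [w|v] c x y; last by rewrite /= el scalerDl -scalerA.
by rewrite /= scalerDr !scalerA [e w * c]mulrC.
Qed.

Section Tmul.
Variables (V W : lmodType k) (mV : V -> V -> V) (mW : W -> W -> W).
Hypotheses (Vb : is_bilinear mV) (Wb : is_bilinear mW).

Lemma tmul_inner_bilinear v w :
  is_bilinear (fun v' w' => mV v v' \ox mW w w').
Proof. by split=> [y|x] c z z'; rewrite ?(Vb.2 v) ?(Wb.2 w) ?tensl ?tensr. Qed.

Lemma tmul_outer_bilinear y :
  is_bilinear (fun v w => tlift (fun v' w' => mV v v' \ox mW w w') y).
Proof.
split=> [w|v].
  apply: (tensor_family_bilinear (F := fun v => tlift _) _ _).2 => [v|v' w'].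
    exact: tlift_linear (tmul_inner_bilinear v w).
  rewrite (_ : (fun v => _) = fun v => mV v v' \ox mW w w').
    by move=> c x x'; rewrite (Vb.1 v') tensl.
  by apply/funext => v; exact: (tlift_tens (tmul_inner_bilinear v w)).
apply: (tensor_family_bilinear (F := fun w => tlift _) _ _).2 => [w|v' w'].
  exact: tlift_linear (tmul_inner_bilinear v w).
rewrite (_ : (fun w => _) = fun w => mV v v' \ox mW w w').
  by move=> c x x'; rewrite (Wb.1 w') tensr.
by apply/funext => w; exact: (tlift_tens (tmul_inner_bilinear v w)).
Qed.

Lemma tmul_tens v w v' w' :
  tmul mV mW (v \ox w) (v' \ox w') = mV v v' \ox mW w w'.
Proof.
rewrite /tmul tlift_tens; last exact: tmul_outer_bilinear.
by rewrite tlift_tens //; apply: tmul_inner_bilinear.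
Qed.

Lemma tmul_bilinear : is_bilinear (tmul mV mW).
Proof.
apply: (tensor_family_bilinear (F := fun y x => tmul mV mW x y)) => [y|v w].
  exact: tlift_linear (tmul_outer_bilinear y).
rewrite (_ : (fun y => _) = tlift (fun v' w' => mV v v' \ox mW w w')).
  exact: tlift_linear (tmul_inner_bilinear v w).
by apply/funext => y; exact: (tlift_tens (tmul_outer_bilinear y)).
Qed.

End Tmul.

Lemma tensor2_eq V W V' W' Z (f g : tensor V W -> tensor V' W' -> Z) :
  is_bilinear f -> is_bilinear g ->
  (forall v w v' w', f (v \ox w) (v' \ox w') = g (v \ox w) (v' \ox w')) ->
  forall x y, f x y = g x y.
Proof.
move=> fb gb fg x y; move: x; apply: tensor_eq => [||v w].
- exact: fb.1.
- exact: gb.1.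
move: y; apply: tensor_eq => [||v' w']; last exact: fg.
- exact: fb.2.
- exact: gb.2.
Qed.

Lemma tmap_tmul V V' (m : V -> V -> V) (m' : V' -> V' -> V') (i j : V -> V') x y :
    is_bilinear m -> is_bilinear m' -> linear i -> linear j ->
    (forall u v, i (m u v) = m' (i u) (i v)) ->
    (forall u v, j (m u v) = m' (j u) (j v)) ->
  tmap i j (tmul m m x y) = tmul m' m' (tmap i j x) (tmap i j y).
Proof.
move=> mb mb' il jl iM jM; have ijl := tmap_linear il jl.
have tb := tmul_bilinear mb mb; have tb' := tmul_bilinear mb' mb'.
pose F a b := tmap i j (tmul m m a b).
pose G a b := tmul m' m' (tmap i j a) (tmap i j b).
apply: (@tensor2_eq _ _ _ _ _ F G) => [||v w v' w']; rewrite /F /G.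
- by split=> [z|z] c a b; rewrite ?(tb.1 z) ?(tb.2 z) ijl.
- by split=> [z|z] c a b; rewrite ijl ?(tb'.1 (tmap i j z)) ?(tb'.2 (tmap i j z)).
- by rewrite tmul_tens // !tmap_tens // tmul_tens // iM jM.
Qed.

End TensorMaps.

(** * Hopf structures along an injective linear map *)

(** As [i \o r] is a projection onto the image of [i], the hypotheses say that
    this image is stable under all operations of [h]. This covers at once the
    restriction of a Hopf structure to a subspace ([i] an inclusion) and its
    conjugation by a linear automorphism ([i] bijective). Each axiom is checked
    after applying [i], [i ⊗ i] or [i ⊗ i ⊗ i], which are injective because [r] is a
    left inverse. *)
Section Transport.
Context {k : fieldType}.
Variables (P Q : lmodType k) (h : hopfAlg P) (i : Q -> P) (r : P -> Q).
Hypotheses (il : linear i) (rl : linear r) (ri : cancel i r).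
Local Notation "x *_h y" := (hpmul h x y) (at level 40, left associativity).
Hypothesis ir1 : i (r (hpone h)) = hpone h.
Hypothesis irM : forall x y, i (r (i x *_h i y)) = i x *_h i y.
Hypothesis irD : forall x,
  tmap (i \o r) (i \o r) (hpcomul h (i x)) = hpcomul h (i x).
Hypothesis irS : forall x, i (r (hpanti h (i x))) = hpanti h (i x).

Let mb := hpmul_bilinear h.
Let Dl := hpcomul_linear h.
Let ii_inj : injective (tmap i i).
Proof.
apply: (can_inj (g := tmap r r)) => t; rewrite tmap_comp //.
by rewrite (_ : r \o i = id) ?tmap_id //; apply/funext => x; exact: ri.
Qed.
Let iil := tmap_linear il il.
Let iii_inj : injective (tmap i (tmap i i)).
Proof.
have rrl := tmap_linear rl rl.
apply: (can_inj (g := tmap r (tmap r r))) => t; rewrite tmap_comp //.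
rewrite (_ : r \o i = id); last by apply/funext => x; exact: ri.
rewrite (_ : _ \o _ = id) ?tmap_id //; apply/funext => x /=.
rewrite tmap_comp // (_ : r \o i = id) ?tmap_id //.
by apply/funext => y; exact: ri.
Qed.
Let i_inj : injective i := can_inj ri.

Definition pull_mul x y := r (i x *_h i y).
Definition pull_one := r (hpone h).
Definition pull_comul x := tmap r r (hpcomul h (i x)).
Definition pull_counit x := hpcounit h (i x).
Definition pull_anti x := r (hpanti h (i x)).

Let iM x y : i (pull_mul x y) = i x *_h i y. Proof. exact: irM. Qed.
Let iD x : tmap i i (pull_comul x) = hpcomul h (i x).
Proof. by rewrite tmap_comp ?irD. Qed.
Let iS x : i (pull_anti x) = hpanti h (i x). Proof. exact: irS. Qed.

Fact pull_mul_bilinear : is_bilinear pull_mul.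
Proof.
by split=> [z|z] c x y; rewrite /pull_mul il ?(mb.1 (i z)) ?(mb.2 (i z)) rl.
Qed.
Fact pull_mulA : associative pull_mul.
Proof. by move=> x y z; apply: i_inj; rewrite !iM hpmulA. Qed.
Fact pull_mul1l : left_id pull_one pull_mul.
Proof. by move=> x; apply: i_inj; rewrite iM ir1 hpmul1l. Qed.
Fact pull_mul1r : right_id pull_one pull_mul.
Proof. by move=> x; apply: i_inj; rewrite iM ir1 hpmul1r. Qed.
Fact pull_comul_linear : linear pull_comul.
Proof. by move=> c x y; rewrite /pull_comul il Dl tmap_linear. Qed.
Fact pull_counit_linear : scalar pull_counit.
Proof. by move=> c x y; rewrite /pull_counit il (hpcounit_linear h). Qed.
Fact pull_anti_linear : linear pull_anti.
Proof. by move=> c x y; rewrite /pull_anti il (hpanti_linear h) rl. Qed.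

Fact pull_comulA x : tassoc (tmap pull_comul id (pull_comul x)) =
  tmap id pull_comul (pull_comul x).
Proof.
have Tl := pull_comul_linear.
have idl (V : lmodType k) : linear (@id V) by [].
have E : tmap i i \o pull_comul = hpcomul h \o i by apply/funext => y; exact: iD.
apply: iii_inj; rewrite -(tassoc_nat _ il il il).
rewrite (tmap_comp _ iil Tl il (idl _)) (tmap_comp _ il (idl _) iil Tl) E.
have := hpcomulA h (i x).
by rewrite -iD (tmap_comp _ Dl il (idl _) il) (tmap_comp _ (idl _) il Dl il).
Qed.

Fact pull_counitl x : tlift (fun y z => pull_counit y *: z) (pull_comul x) = x.
Proof.
apply: i_inj; rewrite (tlift_comp _ (@scale_bilinearl _ _ _ _ pull_counit_linear) il).
rewrite -[RHS](hpcounitl h) -iD.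
rewrite (tlift_tmap il il _ (@scale_bilinearl _ _ _ _ (hpcounit_linear h))).
by congr (tlift _ _); apply/funext => y; apply/funext => z; rewrite (linZ il).
Qed.

Fact pull_counitr x : tlift (fun y z => pull_counit z *: y) (pull_comul x) = x.
Proof.
apply: i_inj; rewrite (tlift_comp _ (@scale_bilinearr _ _ _ _ pull_counit_linear) il).
rewrite -[RHS](hpcounitr h) -iD.
rewrite (tlift_tmap il il _ (@scale_bilinearr _ _ _ _ (hpcounit_linear h))).
by congr (tlift _ _); apply/funext => y; apply/funext => z; rewrite (linZ il).
Qed.

Fact pull_comulM x y :
  pull_comul (pull_mul x y) = tmul pull_mul pull_mul (pull_comul x) (pull_comul y).
Proof.
apply: ii_inj; rewrite (tmap_tmul (m' := hpmul h)) //; last exact: pull_mul_bilinear.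
by rewrite !iD iM hpcomulM.
Qed.
Fact pull_comul1 : pull_comul pull_one = pull_one \ox pull_one.
Proof. by rewrite /pull_comul ir1 hpcomul1 tmap_tens. Qed.
Fact pull_counitM x y : pull_counit (pull_mul x y) = pull_counit x * pull_counit y.
Proof. by rewrite /pull_counit iM hpcounitM. Qed.
Fact pull_counit1 : pull_counit pull_one = 1.
Proof. by rewrite /pull_counit ir1 hpcounit1. Qed.

Fact pull_antil x :
  tlift (fun y z => pull_mul (pull_anti y) z) (pull_comul x) = pull_counit x *: pull_one.
Proof.
have Tb := pull_mul_bilinear.
apply: i_inj; rewrite (linZ il) ir1 /pull_counit -hpantil -iD tlift_comp //; last first.
  by split=> [z|z] c u v; rewrite ?pull_anti_linear ?(Tb.1 z) ?(Tb.2 (pull_anti z)).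
rewrite tlift_tmap //; last first.
  by split=> [z|z] c u v; rewrite ?(hpanti_linear h) ?(mb.1 z) ?(mb.2 (hpanti h z)).
by congr (tlift _ _); apply/funext => y; apply/funext => z; rewrite iM iS.
Qed.
Fact pull_antir x :
  tlift (fun y z => pull_mul y (pull_anti z)) (pull_comul x) = pull_counit x *: pull_one.
Proof.
have Tb := pull_mul_bilinear.
apply: i_inj; rewrite (linZ il) ir1 /pull_counit -hpantir -iD tlift_comp //; last first.
  by split=> [z|z] c u v; rewrite ?pull_anti_linear ?(Tb.2 z) ?(Tb.1 (pull_anti z)).
rewrite tlift_tmap //; last first.
  by split=> [z|z] c u v; rewrite ?(hpanti_linear h) ?(mb.2 z) ?(mb.1 (hpanti h z)).
by congr (tlift _ _); apply/funext => y; apply/funext => z; rewrite iM iS.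
Qed.

Definition hopf_transport : hopfAlg Q := HopfAlg
  pull_mul_bilinear pull_mulA pull_mul1l pull_mul1r pull_comul_linear pull_counit_linear
  pull_anti_linear pull_comulA pull_counitl pull_counitr pull_comulM pull_comul1
  pull_counitM pull_counit1 pull_antil pull_antir.

End Transport.

(** * Shuffle permutations and merging sets as lists *)
Section Shuffles.

Fixpoint shuffles (T : Type) (s : seq T) : seq T -> seq (seq T) :=
  fix shuffles_s t :=
    match s, t with
    | [::], _ => [:: t]
    | _, [::] => [:: s]
    | x :: s', y :: t' =>
        [seq x :: l | l <- shuffles s' t] ++ [seq y :: l | l <- shuffles_s t']
    end.

Lemma shuffles0s T (t : seq T) : shuffles [::] t = [:: t].
Proof. by case: t. Qed.

Lemma shuffless0 T (s : seq T) : shuffles s [::] = [:: s].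
Proof. by case: s. Qed.

Lemma shuffles_cons T x y (s t : seq T) :
  shuffles (x :: s) (y :: t) =
  [seq x :: l | l <- shuffles s (y :: t)] ++ [seq y :: l | l <- shuffles (x :: s) t].
Proof. by []. Qed.

Arguments shuffles : simpl never.

Lemma map_shuffles T T' (g : T -> T') s t :
  shuffles (map g s) (map g t) = [seq map g l | l <- shuffles s t].
Proof.
elim: s t => [|x s IHs]; first by move=> t; rewrite !shuffles0s.
elim=> [//|y t IHt].
rewrite [map g _]/= [map g (y :: t)]/= !shuffles_cons (IHs (y :: t)) IHt.
by rewrite map_cat -!map_comp.
Qed.

Variables (T : eqType) (p : pred T).

(** A letter of [l] satisfies [p] exactly when it comes from [s]; this is why
    the two filters determine the interleaving. *)
Lemma mem_shuffles s t l : all p s -> all (predC p) t ->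
  (l \in shuffles s t) = (filter p l == s) && (filter (predC p) l == t).
Proof.
have nilE (q : pred T) r : (filter q r == [::]) = all (predC q) r.
  by rewrite all_predC has_filter negbK.
elim: s t l => [|x s IHs].
  move=> t l _ pt; rewrite shuffles0s inE nilE.
  apply/eqP/andP => [->|[/all_filterP-> /eqP//]].
  by split; last rewrite (all_filterP pt).
elim=> [|y t IHt] l ps pt.
  have predCK r : all (predC (predC p)) r = all p r.
    by apply: eq_all => z /=; rewrite negbK.
  rewrite shuffless0 inE nilE predCK.
  apply/eqP/andP => [->|[/eqP E /all_filterP pl]]; last by rewrite -E pl.
  by split; first rewrite (all_filterP ps).
have /andP[px ps'] : p x && all p s := ps.
have /andP[py pt'] : ~~ p y && all (predC p) t := pt.
have consE z r (L : seq (seq T)) : (r \in [seq z :: l' | l' <- L]) =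
    if r is z' :: r' then (z' == z) && (r' \in L) else false.
  case: r => [|z' r']; first by apply/negP => /mapP[].
  apply/mapP/andP => [[l' l'L [-> ->]]|[/eqP-> r'L]]; first by [].
  by exists r'.
rewrite shuffles_cons mem_cat !consE; case: l => [|z l] //=.
case pz: (p z) => /=.
  have -> : (z == y) = false by apply: contraTF pz => /eqP->.
  by rewrite andFb orbF (IHs (y :: t)) // eqseq_cons andbA.
have -> : (z == x) = false by apply: contraFF pz => /eqP->.
by rewrite andFb /= (IHt l) // !eqseq_cons andbCA.
Qed.

Lemma uniq_shuffles s t : all p s -> all (predC p) t -> uniq (shuffles s t).
Proof.
elim: s t => [|x s IHs]; first by move=> t; rewrite shuffles0s.
elim=> [//|y t IHt] ps pt.
have /andP[px ps'] : p x && all p s := ps.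
have /andP[py pt'] : ~~ p y && all (predC p) t := pt.
have consI z : injective (cons z : seq T -> seq T) by move=> ? ? [].
rewrite shuffles_cons cat_uniq !map_inj_uniq // (IHs (y :: t)) // (IHt ps pt') andbT.
apply/hasPn => _ /mapP[l _ ->]; apply/mapP => -[l' _ [yx _]].
by rewrite yx px in py.
Qed.

End Shuffles.

Section OneLine.

Definition one_line N (s : 'S_N) : seq nat := [seq val (s i) | i <- enum 'I_N].

Lemma size_one_line N (s : 'S_N) : size (one_line s) = N.
Proof. by rewrite size_map size_enum_ord. Qed.

Lemma nth_one_line N (s : 'S_N) (i : 'I_N) : nth 0%N (one_line s) i = s i.
Proof. by rewrite (nth_map i) ?size_enum_ord // nth_ord_enum. Qed.

Lemma one_line_inj N : injective (@one_line N).
Proof.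
move=> s s' E; apply/permP => i; apply: val_inj.
have /= := congr1 (fun l => nth 0%N l i) E.
by rewrite !nth_one_line.
Qed.

Lemma perm_one_line N (s : 'S_N) : perm_eq (one_line s) (iota 0 N).
Proof.
rewrite -val_enum_ord /one_line (map_comp val); apply: perm_map.
apply: uniq_perm; last 1 first.
- move=> i; rewrite mem_enum; apply/mapP; exists ((s^-1)%g i); rewrite ?mem_enum //.
  by rewrite permKV.
- by rewrite map_inj_uniq ?enum_uniq //; apply: perm_inj.
- exact: enum_uniq.
Qed.

Lemma one_line_surj N (l : seq nat) :
  perm_eq l (iota 0 N) -> exists s : 'S_N, one_line s = l.
Proof.
move=> lP; have szl : size l = N by rewrite (perm_size lP) size_iota.
have lt i : (i < N)%N -> (nth 0%N l i < N)%N.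
  move=> iN; have : nth 0%N l i \in iota 0 N.
    by rewrite -(perm_mem lP) mem_nth ?szl.
  by rewrite mem_iota.
pose g (i : 'I_N) := Ordinal (lt i (ltn_ord i)).
have gI : injective g.
  move=> i j /(congr1 val) /= /eqP; rewrite nth_uniq ?szl //.
    by move=> /eqP/val_inj.
  by rewrite (perm_uniq lP) iota_uniq.
exists (perm gI); apply: (@eq_from_nth _ 0%N).
  by rewrite size_map size_enum_ord.
move=> i; rewrite size_map size_enum_ord => iN.
rewrite (nth_map (Ordinal iN)) ?size_enum_ord // permE /= nth_enum_ord //.
Qed.

Lemma filter_iota_lt m n : filter (fun i => i < m)%N (iota 0 (m + n)) = iota 0 m.
Proof.
rewrite iotaD filter_cat add0n.
have /all_filterP-> : all (fun i => i < m)%N (iota 0 m).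
  by apply/allP => i; rewrite mem_iota.
rewrite (@eq_in_filter _ _ pred0) ?filter_pred0 ?cats0 // => i.
by rewrite mem_iota => /andP[mi _]; rewrite ltnNge mi.
Qed.

Lemma filter_iota_ge m n :
  filter (predC (fun i => i < m)%N) (iota 0 (m + n)) = iota m n.
Proof.
rewrite iotaD filter_cat add0n.
have /all_filterP-> : all (predC (fun i => i < m)%N) (iota m n).
  by apply/allP => i; rewrite mem_iota /= -leqNgt => /andP[].
rewrite (@eq_in_filter _ _ pred0) ?filter_pred0 // => i.
by rewrite mem_iota /= => ->.
Qed.

(** The inverse permutation gives the positions of the values in the one-line
    notation, so being increasing there is being sorted there. *)
Lemma filter_one_line_sorted N (s : 'S_N) (q : pred nat) :
  reflect (forall i j : 'I_N, (i < j)%N -> q i -> q j ->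
             ((s^-1)%g i < (s^-1)%g j)%N)
          (sorted ltn (filter q (one_line s))).
Proof.
have sF : sorted (relpre val ltn) (filter (q \o (val \o s)) (enum 'I_N)).
  apply: sorted_filter; first by move=> ? ? ?; apply: ltn_trans.
  by rewrite -sorted_map val_enum_ord iota_ltn_sorted.
rewrite /one_line filter_map.
apply: (iffP idP) => [S i j ij qi qj|H].
  set F := filter _ _ in S sF.
  have mF (u : 'I_N) : q u -> (s^-1)%g u \in F.
    by move=> qu; rewrite mem_filter mem_enum /= permKV qu.
  rewrite sorted_map in S.
  case: (ltngtP (index ((s^-1)%g i) F) (index ((s^-1)%g j) F)) => [lt|lt|eq].
  - apply: (sorted_ltn_index _ sF) => //; try exact: mF.
    by move=> ? ? ?; apply: ltn_trans.
  - have : relpre (val \o s) ltn ((s^-1)%g j) ((s^-1)%g i).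
      apply: (sorted_ltn_index _ S) => //; try exact: mF.
      by move=> ? ? ?; apply: ltn_trans.
    by rewrite /= !permKV ltnNge ltnW.
  - have : (s^-1)%g i = (s^-1)%g j.
      by rewrite -(nth_index i (mF _ qi)) -[RHS](nth_index i (mF _ qj)) eq.
    by move/perm_inj => E; rewrite E ltnn in ij.
rewrite sorted_map.
apply: (sub_in_sorted (P := mem (q \o (val \o s))) _ _ sF); last first.
  by apply/allP => i; rewrite mem_filter => /andP[].
move=> i j qi qj /= ij.
rewrite ltnNge leq_eqVlt; apply/norP; split.
  by apply: contraTN ij => /eqP/val_inj/perm_inj->; rewrite ltnn.
apply: contraTN ij => ji; rewrite -leqNgt ltnW //.
by have := H _ _ ji qj qi; rewrite !permK.
Qed.

Lemma is_shuffleE m n (s : 'S_(m + n)) :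
  is_shuffle s = (one_line s \in shuffles (iota 0 m) (iota m n)).
Proof.
rewrite (@mem_shuffles _ (fun i => i < m)%N); first last.
- by apply/allP => i; rewrite mem_iota /= -leqNgt => /andP[].
- by apply/allP => i; rewrite mem_iota.
have P := perm_one_line s.
have sortedE (q : pred nat) :
    sorted ltn (filter q (one_line s)) =
    (filter q (one_line s) == filter q (iota 0 (m + n))).
  have sI : sorted ltn (filter q (iota 0 (m + n))).
    by apply: sorted_filter (iota_ltn_sorted _ _); apply: ltn_trans.
  apply/idP/eqP => [S|->//].
  apply: (irr_sorted_eq _ _ S sI) => [|x|x].
  - exact: ltn_trans.
  - exact: ltnn.
  - by apply/perm_mem/perm_filter.
rewrite -(filter_iota_lt m n) -(filter_iota_ge m n) -!sortedE.
apply/forallP/andP => [H|[/filter_one_line_sorted H1 /filter_one_line_sorted H2] i].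
  split; apply/filter_one_line_sorted => i j ij qi qj;
    have /forallP/(_ j)/implyP := H i; apply; rewrite ij /=.
    by rewrite qj.
  by move: qi; rewrite /= -leqNgt => ->; rewrite orbT.
apply/forallP => j; apply/implyP => /andP[ij /orP[jm|mi]].
  by apply: H1 => //; apply: ltn_trans jm.
by apply: H2; rewrite //= -leqNgt // (leq_trans mi) // ltnW.
Qed.

(** Shuffle permutations correspond, via one-line notation, to the
    interleavings of the two blocks of values. *)
Lemma sum_is_shuffle (Z : nmodType) m n (F : seq nat -> Z) :
  \sum_(s : 'S_(m + n) | is_shuffle s) F (one_line s) =
  \sum_(l <- shuffles (iota 0 m) (iota m n)) F l.
Proof.
pose p i := (i < m)%N.
have ps : all p (iota 0 m) by apply/allP => i; rewrite mem_iota.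
have pt : all (predC p) (iota m n).
  by apply/allP => i; rewrite mem_iota /= -leqNgt => /andP[].
have PE : perm_eq [seq one_line s | s <- enum (@is_shuffle m n)]
                  (shuffles (iota 0 m) (iota m n)).
  apply: uniq_perm; last first.
  - move=> l; apply/mapP/idP => [[s]|lS].
      by rewrite mem_enum => sS ->; rewrite -is_shuffleE.
    have [|s sl] := @one_line_surj (m + n) l.
      move: lS; rewrite (mem_shuffles _ ps pt) => /andP[/eqP E1 /eqP E2].
      by rewrite iotaD add0n -E1 -E2 perm_sym perm_filterC.
    exists s => //; rewrite mem_enum; change (is_shuffle s).
    by rewrite is_shuffleE sl.
  - exact: uniq_shuffles ps pt.
  - by rewrite map_inj_uniq ?enum_uniq //; apply: one_line_inj.
by rewrite -(perm_big _ PE) big_map big_enum.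
Qed.

End OneLine.

Section Masks.

Fixpoint bitseqs N : seq bitseq :=
  if N is N'.+1 then
    [seq false :: b | b <- bitseqs N'] ++ [seq true :: b | b <- bitseqs N']
  else [:: [::]].

Lemma mem_bitseqs N b : (b \in bitseqs N) = (size b == N).
Proof.
have consE z r (L : seq bitseq) : (r \in [seq z :: l' | l' <- L]) =
    if r is z' :: r' then (z' == z) && (r' \in L) else false.
  case: r => [|z' r']; first by apply/negP => /mapP[].
  apply/mapP/andP => [[l' l'L [-> ->]]|[/eqP-> r'L]]; first by [].
  by exists r'.
elim: N b => [|N IH] [|c b] //=; rewrite mem_cat !consE //= !IH.
by case: c => //=; rewrite orbF.
Qed.

Lemma uniq_bitseqs N : uniq (bitseqs N).
Proof.
have consI z : injective (cons z : bitseq -> bitseq) by move=> ? ? [].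
elim: N => //= N IH; rewrite cat_uniq !map_inj_uniq // IH /= andbT.
by apply/hasPn => _ /mapP[l _ ->]; apply/mapP => -[].
Qed.

Definition set_mask N (T : {set 'I_N}) : bitseq := [seq i \in T | i <- enum 'I_N].

Lemma size_set_mask N (T : {set 'I_N}) : size (set_mask T) = N.
Proof. by rewrite size_map size_enum_ord. Qed.

Lemma nth_set_mask N (T : {set 'I_N}) (i : 'I_N) :
  nth false (set_mask T) i = (i \in T).
Proof. by rewrite (nth_map i) ?size_enum_ord // nth_ord_enum. Qed.

Lemma sum_set_mask (Z : nmodType) N (F : bitseq -> Z) :
  \sum_(T : {set 'I_N}) F (set_mask T) = \sum_(b <- bitseqs N) F b.
Proof.
have PE : perm_eq [seq set_mask T | T <- enum {set 'I_N}] (bitseqs N).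
  apply: uniq_perm; last first.
  - move=> b; rewrite mem_bitseqs; apply/mapP/eqP => [[T _ ->]|sb].
      exact: size_set_mask.
    exists [set i : 'I_N | nth false b i]%SET; first by rewrite mem_enum.
    apply: (@eq_from_nth _ false); first by rewrite size_set_mask.
    by move=> i; rewrite sb => iN; rewrite (nth_set_mask _ (Ordinal iN)) inE.
  - exact: uniq_bitseqs.
  - rewrite map_inj_uniq ?enum_uniq // => T T' E; apply/setP => i.
    by rewrite -!nth_set_mask E.
by rewrite -(perm_big _ PE) big_map big_enum.
Qed.

End Masks.

(** * The recursion of the mixable shuffle product *)
Section Concat.
Context {k : fieldType}.

Lemma tpow_eq (V Z : lmodType k) (f g : tpow V -> Z) : linear f -> linear g ->
  (forall s, f (pten s) = g (pten s)) -> f =1 g.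
Proof. exact: plift_eq. Qed.

(** Sealed: comparing two such values must not unfold the quotient that defines
    tensor powers. *)
Definition tcons (V : lmodType k) (a : V) : tpow V -> tpow V :=
  locked (tplift (fun s => pten (a :: s))).

Lemma tcons_multilinear (V : lmodType k) (a : V) :
  multilinear (fun s => pten (a :: s)).
Proof. move=> s t; exact: (@pten_multilinear k V (a :: s) t). Qed.

Lemma tcons_pten (V : lmodType k) (a : V) s : tcons a (pten s) = pten (a :: s).
Proof. by rewrite /tcons -lock tplift_pten //; apply: tcons_multilinear. Qed.

Lemma tcons_linear (V : lmodType k) (a : V) : linear (tcons a).
Proof. by rewrite /tcons -lock; exact: tplift_linear (tcons_multilinear a). Qed.

HB.instance Definition _ (V : lmodType k) (a : V) :=
  GRing.isLinear.Build k (tpow V) (tpow V) _ (tcons a) (tcons_linear a).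

End Concat.

Section Recursion.
Context {k : fieldType}.
Variables (B : comNuAlg k) (lam : k).
Local Notation "x *_B y" := (@numul k B x y)
  (at level 40, left associativity, only parsing).

Fixpoint qshuffle (a : seq B) : seq B -> tpow B :=
  fix qshuffle_a b :=
    match a, b with
    | [::], _ => pten b
    | _, [::] => pten a
    | x :: a', y :: b' =>
        tcons x (qshuffle a' b) + tcons y (qshuffle_a b')
          + lam *: tcons (x *_B y) (qshuffle a' b')
    end.

Lemma qshuffle0s b : qshuffle [::] b = pten b. Proof. by case: b. Qed.
Lemma qshuffles0 a : qshuffle a [::] = pten a. Proof. by case: a. Qed.
Lemma qshuffle_cons x a y b : qshuffle (x :: a) (y :: b) =
  tcons x (qshuffle a (y :: b)) + tcons y (qshuffle (x :: a) b)
  + lam *: tcons (x *_B y) (qshuffle a b).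
Proof. by []. Qed.

Arguments qshuffle : simpl never.

Lemma contract_false (J J' : pred nat) (x : B) (v : seq B) :
    J 0%N = false -> (forall i, J i.+1 = J' i) ->
  contract J (x :: v) = x :: contract J' v.
Proof.
move=> J0 JJ; rewrite /contract /= J0; congr (_ :: _).
rewrite (iotaDl 1 0) filter_map -map_comp.
rewrite (@eq_filter _ _ (fun i => ~~ ((0 < i)%N && J' i.-1))).
  by apply: eq_map => i /=; rewrite !add1n JJ.
by case=> [|i] /=; rewrite ?J0 ?add1n ?JJ.
Qed.

Lemma contract_true (J J' : pred nat) (x y : B) (v : seq B) : J 0%N -> J 1%N = false ->
    (forall i, J i.+2 = J' i) ->
  contract J (x :: y :: v) = (x *_B y) :: contract J' v.
Proof.
move=> J0 J1 JJ; rewrite /contract /= J0 /=; congr (_ :: _).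
rewrite (iotaDl 2 0) filter_map -map_comp.
rewrite (@eq_filter _ _ (fun i => ~~ ((0 < i)%N && J' i.-1))).
  by apply: eq_map => i /=; rewrite !add2n JJ.
by case=> [|i] /=; rewrite ?J1 ?add2n ?JJ.
Qed.

(** [b] marks the positions that are merged with the next one, [t] tells which
    letters come from the second factor. *)
Fixpoint merge_ok (b t : bitseq) : bool :=
  if b is c :: b' then
    (c ==> (if t is [:: false, true & _] then true else false))
      && merge_ok b' (behead t)
  else true.

(** The sum over merging sets, for letters tagged with [true] when they come
    from the second factor: the first letter is kept, or merged with the next one
    if it ends a block of the first factor. *)
Fixpoint merge_sum (l : seq (bool * B)) : tpow B :=
  if l is p :: l' then
    tcons p.2 (merge_sum l') +
    (if l' is q :: l'' then
       if ~~ p.1 && q.1 then lam *: tcons (p.2 *_B q.2) (merge_sum l'') else 0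
     else 0)
  else pten [::].

Lemma merge_okP b t : reflect
  (forall i, nth false b i ->
     [/\ (i.+1 < size t)%N, nth false t i = false & nth false t i.+1])
  (merge_ok b t).
Proof.
elim: b t => [|c b IH] t /=; first by constructor=> i; rewrite nth_nil.
apply: (iffP andP) => [[ct /IH bt] [|i] /=|H].
- by case: c ct => //= + _; case: t {bt} => [|[] [|[] t]].
- by move/bt; case: t {ct bt} => [|d t] /= [].
- split.
    apply/implyP => cT; have := H 0%N cT.
    by case: t {H} => [|[] [|[] t]] // [].
  by apply/IH => i bi; have := H i.+1 bi; case: t {H} => [|d t] /= [].
Qed.

(** Induction on the length. If the first position is merged, the second one
    cannot be, since its letter comes from the second factor; hence two letters are
    consumed at once. *)
Lemma merge_sumE l :
  \sum_(b <- bitseqs (size l) | merge_ok b (unzip1 l))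
     lam ^+ count id b *: pten (contract (nth false b) (unzip2 l)) =
  merge_sum l.
Proof.
have step (p : bool * B) l' :
    \sum_(b <- bitseqs (size l') | merge_ok (false :: b) (unzip1 (p :: l')))
      lam ^+ count id (false :: b) *:
        pten (contract (nth false (false :: b)) (unzip2 (p :: l'))) =
    tcons p.2 (\sum_(b <- bitseqs (size l') | merge_ok b (unzip1 l'))
      lam ^+ count id b *: pten (contract (nth false b) (unzip2 l'))).
  rewrite (linear_sum (tcons _)) /=; apply: eq_bigr => b _.
  rewrite (linearZ_LR (tcons _)) /= tcons_pten; congr (_ *: pten _).
  exact: contract_false.
have [n le_n] := ubnP (size l); elim: n l le_n => // n IH [|p l'] /=.
  by rewrite big_cons big_nil /= addr0 scale1r.
rewrite ltnS => le_n; rewrite big_cat !big_map /= step IH //; congr (_ + _).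
case: l' le_n => [|q l''] /= le_n.
  by apply: big1 => b; case: p.1.
rewrite big_cat !big_map /= [X in _ + X]big1 ?addr0; last first.
  by move=> b; case: p.1 => //; case: q.1.
case: p.1 => /=; first by rewrite big_pred0.
case: q.1 => /=; last by rewrite big_pred0.
rewrite -(IH l'') 1?ltnW // (linear_sum (tcons _)) /= scaler_sumr.
apply: eq_bigr => b _.
rewrite (linearZ_LR (tcons _)) /= tcons_pten scalerA -exprS; congr (_ *: pten _).
exact: contract_true.
Qed.

(** Interleavings of [x :: a] and [y :: b] start with [x] or with [y]; [x] can be
    merged with its successor exactly when the latter is [y]. *)
Lemma sum_shuffles_merge a b :
  \sum_(l <- shuffles (map (pair false) a) (map (pair true) b)) merge_sum l =
  qshuffle a b.
Proof.
have one c (s : seq B) : merge_sum (map (pair c) s) = pten s.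
  elim: s => // x s IH; rewrite [LHS]/= IH tcons_pten.
  by case: s {IH} => [|y s] /=; rewrite ?andNb addr0.
elim: a b => [|x a IHa] b.
  by rewrite shuffles0s big_seq1 one qshuffle0s.
elim: b => [|y b IHb]; first by rewrite shuffless0 big_seq1 one.
rewrite [map _ (x :: a)]/= [map _ (y :: b)]/= shuffles_cons qshuffle_cons.
rewrite big_cat !big_map -[RHS]addrA [X in _ = _ + X]addrC [RHS]addrA.
congr (_ + _); last first.
  rewrite -IHb (linear_sum (tcons _)) /=; apply: eq_bigr => l _ /=.
  by case: l => [|q l]; rewrite addr0.
rewrite -(IHa (y :: b)) (linear_sum (tcons _)) big_split.
congr (_ + _); rewrite -IHa; case: a {IHa IHb} => [|x' a].
  (* With [a] empty, [y] is the only possible successor of [x]. *)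
  by rewrite !shuffles0s !big_seq1.
rewrite [map _ (x' :: a)]/= shuffles_cons big_cat !big_map /= big1 // add0r.
by rewrite (linear_sum (tcons _)) /= scaler_sumr.
Qed.

(** The summand of a shuffle permutation depends on its one-line notation only,
    and the inner sum over merging sets is [merge_sum] of the tagged word that this
    notation spells. *)
Lemma mixable_shuffleE a b :
  mixable_shuffle lam (size a) (size b) (a ++ b) = qshuffle a b.
Proof.
set m := size a; set n := size b; set u := a ++ b.
pose tag (l : seq nat) : seq (bool * B) := [seq ((m <= i)%N, u`_i) | i <- l].
transitivity (\sum_(s : 'S_(m + n) | is_shuffle s) merge_sum (tag (one_line s))).
  apply: eq_bigr => s _; rewrite -merge_sumE.
  have szl : size (tag (one_line s)) = (m + n)%N.
    by rewrite size_map size_one_line.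
  rewrite szl [LHS]big_mkcond [RHS]big_mkcond -sum_set_mask.
  apply: eq_bigr => T _.
  have -> : (T \subset admissible s) =
            merge_ok (set_mask T) (unzip1 (tag (one_line s))).
    have nthE (i : 'I_(m + n)) :
        nth false (unzip1 (tag (one_line s))) i = (m <= s i)%N.
      rewrite /unzip1 /tag -map_comp (nth_map 0%N) ?size_one_line //=.
      by rewrite nth_one_line.
    apply/fintype.subsetP/merge_okP => [H i|H i iT].
      case: (ltnP i (m + n)) => iN; last first.
        by rewrite nth_default ?size_set_mask.
      rewrite (nth_set_mask T (Ordinal iN)) => /H; rewrite inE.
      case/existsP => j /and3P[/eqP ji lt ge].
      rewrite size_map szl -ji ltn_ord (nthE (Ordinal iN)) nthE ge.
      by rewrite leqNgt lt.
    have := H i; rewrite nth_set_mask => /(_ iT) [].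
    rewrite size_map szl => iN; rewrite nthE (nthE (Ordinal iN)) => lt ge.
    by rewrite inE; apply/existsP; exists (Ordinal iN); rewrite eqxx ge ltnNge lt.
  case: ifP => // _; congr (_ *: _).
    rewrite /set_mask count_map cardE -size_filter; congr (_ ^+ size _).
    by rewrite enumT.
  rewrite /shuffle_term; congr (pten _).
  have -> : unzip2 (tag (one_line s)) = [seq u`_(s i) | i <- enum 'I_(m + n)].
    by rewrite /unzip2 /tag /one_line -!map_comp.
  congr (contract _ _); apply: funext => i.
  case: (ltnP i (m + n)) => iN.
    rewrite (nth_set_mask T (Ordinal iN)).
    apply/existsP/idP => [[t /andP[tT /eqP E]]|iT].
      by rewrite (_ : Ordinal iN = t) //; apply: val_inj.
    by exists (Ordinal iN); rewrite iT /=.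
  rewrite [RHS]nth_default ?size_set_mask //.
  apply/existsP => -[t /andP[_ /eqP E]]; have := ltn_ord t.
  by rewrite E ltnNge iN.
rewrite (sum_is_shuffle m n (merge_sum \o tag)) -sum_shuffles_merge.
have -> : map (pair false) a = tag (iota 0 m).
  apply: (@eq_from_nth _ (false, 0)); rewrite ?size_map ?size_iota // => i im.
  rewrite (nth_map 0) // /tag (nth_map 0%N) ?size_iota // nth_iota // add0n.
  by rewrite leqNgt im /u nth_cat im.
have -> : map (pair true) b = tag (iota m n).
  apply: (@eq_from_nth _ (false, 0)); rewrite ?size_map ?size_iota // => i im.
  rewrite (nth_map 0) // /tag (nth_map 0%N) ?size_iota // nth_iota //.
  by rewrite leq_addr /u nth_cat ltnNge leq_addr /= addKn.
by rewrite map_shuffles big_map.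
Qed.

End Recursion.

(** * The quasi-shuffle algebra *)

Lemma alt_telescope (k : fieldType) (V : lmodType k) (f : nat -> V) n :
  \sum_(j < n.+1) (-1) ^+ j *: (f j.+1 + f j) = f 0%N + (-1) ^+ n *: f n.+1.
Proof.
elim: n => [|n IH]; first by rewrite big_ord1 !expr0 !scale1r addrC.
rewrite big_ord_recr IH /= scalerDr [X in _ + X]addrC addrA; congr (_ + _).
by rewrite -addrA -scalerDl exprS mulN1r addrN scale0r addr0.
Qed.

Section SplitSum.
Context {k : fieldType}.
Variables (V U W Z : lmodType k) (m : U -> W -> Z).

(** Deconcatenation followed by [F], [G] and [m]. Deconcatenation itself is the
    case [m = tens], and convolution products are the case where [m] is a product. *)
Definition split_sum (F : seq V -> U) (G : seq V -> W) (s : seq V) : Z :=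
  \sum_(i < (size s).+1) m (F (take i s)) (G (drop i s)).

Lemma split_sum_nil F G : split_sum F G [::] = m (F [::]) (G [::]).
Proof. by rewrite /split_sum big_ord1. Qed.

Lemma split_sum_cons F G a s : split_sum F G (a :: s) =
  m (F [::]) (G (a :: s)) + split_sum (fun t => F (a :: t)) G s.
Proof. by rewrite /split_sum big_ord_recl. Qed.

(** Each cut leaves the varying letter on one side, at a position that does not
    depend on the letter. *)
Lemma split_sum_multilinear F G : is_bilinear m -> multilinear F ->
  multilinear G -> multilinear (split_sum F G).
Proof.
move=> mb Fm Gm s t c x y; rewrite /split_sum !size_cat /=.
rewrite scaler_sumr -big_split; apply: eq_bigr => i _ /=.
rewrite !take_cat !drop_cat; case: ltnP => [_|_].
  by rewrite Gm (mb.2 (F _)).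
case: (i - size s)%N => [|j] /=; last by rewrite Fm (mb.1 (G _)).
have /= -> := Gm [::] t c x y.
by rewrite (mb.2 (F _)).
Qed.

End SplitSum.

Section QuasiShuffle.
Context {k : fieldType}.

(** The mixable shuffle product, sealed: from here on only the recursion
    [qprod_tcons] is used. *)
Definition qprod (B : comNuAlg k) (lam : k) : tpow B -> tpow B -> tpow B :=
  locked (@shp k B lam).

Lemma qprodE (B : comNuAlg k) (lam : k) : @qprod B lam = @shp k B lam.
Proof. by rewrite /qprod -lock. Qed.

Variables (B : comNuAlg k) (lam : k).
Local Notation "x *_B y" := (@numul k B x y)
  (at level 40, left associativity, only parsing).
Local Notation P := (tpow B).
Local Notation one := (pten [::] : P).
Local Notation "x ** y" := (@qprod B lam x y) (at level 40, left associativity).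

Lemma qprod_bilinear : is_bilinear (@qprod B lam).
Proof. by rewrite qprodE; exact: shp_bilinear. Qed.

Let shl y : linear (fun x => x ** y). Proof. exact: qprod_bilinear.1. Qed.
Let shr x : linear (fun y => x ** y). Proof. exact: qprod_bilinear.2. Qed.
Let tc a : linear (@tcons k B a). Proof. exact: tcons_linear. Qed.

Lemma qprod_pten s t : pten s ** pten t = qshuffle lam s t.
Proof. by rewrite qprodE shp_pten mixable_shuffleE. Qed.

Lemma qprod1l x : one ** x = x.
Proof.
move: x; apply: tpow_eq => [||s]; [exact: shr|exact: lin_id|].
by rewrite qprod_pten qshuffle0s.
Qed.

Lemma qprod1r x : x ** one = x.
Proof.
move: x; apply: tpow_eq => [||s]; [exact: shl|exact: lin_id|].
by rewrite qprod_pten qshuffles0.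
Qed.

Lemma qprod_tcons a x b y : tcons a x ** tcons b y =
  tcons a (x ** tcons b y) + tcons b (tcons a x ** y)
  + lam *: tcons (a *_B b) (x ** y).
Proof.
move: x; apply: tpow_eq => [||s].
- exact: lin_comp (shl _) (tc a).
- apply: lin_add; last by apply: lin_scale; apply: lin_comp (tc _) (shl y).
  apply: lin_add; first by apply: lin_comp (tc _) (shl _).
  exact: lin_comp (tc b) (lin_comp (shl y) (tc a)).
move: y; apply: tpow_eq => [||t].
- exact: lin_comp (shr _) (tc b).
- apply: lin_add; last by apply: lin_scale; apply: lin_comp (tc _) (shr _).
  apply: lin_add; last by apply: lin_comp (tc _) (shr _).
  exact: lin_comp (tc a) (lin_comp (shr _) (tc b)).
by rewrite !tcons_pten !qprod_pten qshuffle_cons.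
Qed.

Lemma qprodC x y : x ** y = y ** x.
Proof.
move: x; apply: tpow_eq => [||s]; [exact: shl|exact: shr|].
move: y; apply: tpow_eq => [||t]; [exact: shr|exact: shl|].
elim: s t => [|a s IHs] t; first by rewrite qprod1l qprod1r.
elim: t => [|b t IHt]; first by rewrite qprod1l qprod1r.
have := IHs (b :: t); have := IHs t; move: IHt; rewrite -!tcons_pten => E1 E2 E3.
rewrite (qprod_tcons a (pten s) b (pten t)).
rewrite (qprod_tcons b (pten t) a (pten s)).
rewrite E1 E2 E3 (numulC a b).
by rewrite (addrC (tcons a (tcons b (pten t) ** pten s))).
Qed.

(** The expansion of a triple product is symmetric in the three factors up to
    commutativity, so that associativity follows from this one-sided form. *)
Lemma qprod3_tcons a x b y c z : (tcons a x ** tcons b y) ** tcons c z =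
  tcons a ((x ** tcons b y) ** tcons c z)
  + tcons b ((tcons a x ** y) ** tcons c z)
  + tcons c ((tcons a x ** tcons b y) ** z)
  + lam *: (tcons (a *_B b) ((x ** y) ** tcons c z)
            + tcons (a *_B c) ((x ** tcons b y) ** z)
            + tcons (b *_B c) ((tcons a x ** y) ** z))
  + (lam * lam) *: tcons ((a *_B b) *_B c) ((x ** y) ** z).
Proof.
rewrite [in LHS]qprod_tcons !(linD (shl _)) (linZ (shl _)) !qprod_tcons.
rewrite !(linD (shl _)) (linZ (shl _)) !(linD (tc c)) (linZ (tc c)).
rewrite !scalerDr !scalerA.
by rewrite (AC (3*3*3) ((1*4*(2*5*8))*(7*3*6)*9)) /= !addrA.
Qed.

Lemma qprodA x y z : x ** (y ** z) = x ** y ** z.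
Proof.
move: x; apply: tpow_eq => [||s]; [exact: shl|exact: lin_comp (shl z) (shl y)|].
move: y; apply: tpow_eq => [||t].
- exact: lin_comp (shr _) (shl z).
- exact: lin_comp (shl z) (shr _).
move: z; apply: tpow_eq => [||u]; [exact: lin_comp (shr _) (shr _)|exact: shr|].
elim: s t u => [|a s IHs] t u; first by rewrite !qprod1l.
elim: t u => [|b t IHt] u; first by rewrite qprod1l qprod1r.
elim: u => [|c u IHu]; first by rewrite !qprod1r.
have Es1 := IHs (b :: t) (c :: u); have Es2 := IHs t (c :: u).
have Es3 := IHs (b :: t) u; have Es4 := IHs t u.
have Et1 := IHt (c :: u); have Et2 := IHt u; have Eu := IHu.
rewrite -!tcons_pten in Es1 Es2 Es3 Es4 Et1 Et2 Eu *.
(* Write [x (y z)] as [(y z) x] to expand both sides with the same lemma. *)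
rewrite qprodC (qprod3_tcons b (pten t) c (pten u) a (pten s)).
rewrite (qprod3_tcons a (pten s) b (pten t) c (pten u)).
rewrite !(qprodC _ (tcons a (pten s))) !(qprodC _ (pten s)).
rewrite Es1 Es2 Es3 Es4 Et1 Et2 Eu.
rewrite (numulC (b *_B c) a) numulA (numulC b a) (numulC c a).
congr (_ + _ *: _ + _); first by rewrite [LHS](AC 3 (3*1*2)).
by rewrite [LHS](AC 3 (2*3*1)).
Qed.

(** * Deconcatenation *)

(** The pure tensor, sealed for the same reason as [tcons]. *)
Definition stens : P -> P -> tensor P P := locked (@tens k P P).
Local Notation "x \ots y" := (stens x y) (at level 40, left associativity).

Lemma stensE x y : x \ots y = x \ox y.
Proof. by rewrite /stens -lock. Qed.

Lemma stens_bilinear : is_bilinear stens.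
Proof. by rewrite /stens -lock; exact: tens_bilinear. Qed.

Let stensl y : linear (fun x => x \ots y). Proof. exact: stens_bilinear.1. Qed.
Let stensr x : linear (fun y => x \ots y). Proof. exact: stens_bilinear.2. Qed.

Lemma stens_eq (Z : lmodType k) (f g : tensor P P -> Z) : linear f -> linear g ->
  (forall x y, f (x \ots y) = g (x \ots y)) -> f =1 g.
Proof.
by move=> fl gl fg; apply: tensor_eq => // x y; have := fg x y; rewrite stensE.
Qed.

Definition deconc : P -> tensor P P :=
  locked (tplift (split_sum stens pten pten)).

Lemma deconc_multilinear : multilinear (split_sum stens pten pten).
Proof.
by apply: split_sum_multilinear; [exact: stens_bilinear|exact: pten_multilinear..].
Qed.

Lemma deconc_linear : linear deconc.
Proof. by rewrite /deconc -lock; exact: tplift_linear deconc_multilinear. Qed.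

Lemma deconc_pten s : deconc (pten s) = split_sum stens pten pten s.
Proof. by rewrite /deconc -lock; exact: tplift_pten deconc_multilinear s. Qed.

Definition counit : P -> k := tplift (fun s => if s is [::] then 1 else 0 : k^o).

Lemma counit_multilinear :
  multilinear (fun s : seq B => if s is [::] then 1 else 0 : k^o).
Proof. by move=> [|? ?] t c x y; rewrite /= scaler0 addr0. Qed.

Lemma counit_linear : scalar counit.
Proof. exact: tplift_linear counit_multilinear. Qed.

Lemma counit_pten s : counit (pten s) = if s is [::] then 1 else 0.
Proof. exact: tplift_pten counit_multilinear s. Qed.

Let counitl : linear (counit : P -> k^o) := counit_linear.

Lemma counit_tcons a x : counit (tcons a x) = 0.
Proof.
move: x; apply: (@tpow_eq k B k^o) => [||s].
- exact: lin_comp counitl (tc a).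
- by move=> c x y; rewrite scaler0 addr0.
- by rewrite tcons_pten counit_pten.
Qed.

Lemma counitM x y : counit (x ** y) = counit x * counit y.
Proof.
move: x; apply: (@tpow_eq k B k^o) => [||s].
- exact: lin_comp counitl (shl y).
- by move=> c x x'; rewrite counit_linear mulrDl -mulrA.
move: y; apply: (@tpow_eq k B k^o) => [||t].
- exact: lin_comp counitl (shr _).
- by move=> c x x'; rewrite counit_linear mulrDr mulrCA.
case: s => [|a s]; first by rewrite qprod1l [counit one]counit_pten mul1r.
case: t => [|b t]; first by rewrite qprod1r [counit one]counit_pten mulr1.
rewrite -!tcons_pten qprod_tcons.
rewrite !(linD counitl).
by rewrite (linZ counitl) !counit_tcons scaler0 !addr0 mul0r.
Qed.

(** Prepending a letter to the first factor; with it, deconcatenation satisfies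
    the recursion [deconc_tcons]. *)
Definition tcons_left (a : B) : tensor P P -> tensor P P :=
  locked (tmap (tcons a) id).
Let tcons_left_linear a : linear (tcons_left a).
Proof. by rewrite /tcons_left -lock; exact: tmap_linear (tc a) (@lin_id _ _). Qed.
Let tcons_left_tens a x y : tcons_left a (x \ots y) = tcons a x \ots y.
Proof.
by rewrite /tcons_left -lock !stensE; exact: tmap_tens (tc a) (@lin_id k P) x y.
Qed.

Lemma deconc_tcons a x : deconc (tcons a x) =
  one \ots tcons a x + tcons_left a (deconc x).
Proof.
move: x; apply: tpow_eq => [||s].
- exact: lin_comp deconc_linear (tc a).
- apply: lin_add; first exact: lin_comp (stensr _) (tc a).
  exact: lin_comp (tcons_left_linear a) deconc_linear.
rewrite !tcons_pten !deconc_pten split_sum_cons; congr (_ + _).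
rewrite /split_sum (lin_sum (tcons_left_linear a)); apply: eq_bigr => i _.
by rewrite tcons_left_tens tcons_pten.
Qed.

Definition qprod2 : tensor P P -> tensor P P -> tensor P P :=
  locked (tmul (@qprod B lam) (@qprod B lam)).
Local Notation "X *_T Y" := (qprod2 X Y) (at level 40, left associativity).
Let tml Y : linear (fun X => X *_T Y).
Proof.
by rewrite /qprod2 -lock; exact: (tmul_bilinear qprod_bilinear qprod_bilinear).1.
Qed.
Let tmr X : linear (fun Y => X *_T Y).
Proof.
by rewrite /qprod2 -lock; exact: (tmul_bilinear qprod_bilinear qprod_bilinear).2.
Qed.
Let tmE x x' y y' : (x \ots x') *_T (y \ots y') = (x ** y) \ots (x' ** y').
Proof.
rewrite /qprod2 -lock !stensE.
exact: tmul_tens qprod_bilinear qprod_bilinear _ _ _ _.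
Qed.

(** The quasi-shuffle recursion only concerns the first tensor factor here,
    hence it lifts to tensors. *)
Lemma qprod2_tcons_left a X b Y : tcons_left a X *_T tcons_left b Y =
  tcons_left a (X *_T tcons_left b Y) + tcons_left b (tcons_left a X *_T Y)
  + lam *: tcons_left (a *_B b) (X *_T Y).
Proof.
move: X; apply: stens_eq => [||x x'].
- exact: lin_comp (tml _) (tcons_left_linear a).
- apply: lin_add; last by apply: lin_scale; apply: lin_comp (tcons_left_linear _) (tml Y).
  apply: lin_add; first by apply: lin_comp (tcons_left_linear _) (tml _).
  exact: lin_comp (tcons_left_linear b) (lin_comp (tml Y) (tcons_left_linear a)).
move: Y; apply: stens_eq => [||y y'].
- exact: lin_comp (tmr _) (tcons_left_linear b).
- apply: lin_add; last by apply: lin_scale; apply: lin_comp (tcons_left_linear _) (tmr _).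
  apply: lin_add; last by apply: lin_comp (tcons_left_linear _) (tmr _).
  exact: lin_comp (tcons_left_linear a) (lin_comp (tmr _) (tcons_left_linear b)).
rewrite !tcons_left_tens !tmE !tcons_left_tens qprod_tcons.
by rewrite !(linD (stensl _)) (linZ (stensl _)).
Qed.

Lemma qprod2_tcons_left1r a X y :
  tcons_left a X *_T (one \ots y) = tcons_left a (X *_T (one \ots y)).
Proof.
move: X; apply: stens_eq => [||x x'].
- exact: lin_comp (tml _) (tcons_left_linear a).
- exact: lin_comp (tcons_left_linear a) (tml _).
by rewrite tcons_left_tens !tmE tcons_left_tens !qprod1r.
Qed.

Lemma qprod2_tcons_left1l b Y x :
  (one \ots x) *_T tcons_left b Y = tcons_left b ((one \ots x) *_T Y).
Proof.
move: Y; apply: stens_eq => [||y y'].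
- exact: lin_comp (tmr _) (tcons_left_linear b).
- exact: lin_comp (tcons_left_linear b) (tmr _).
by rewrite tcons_left_tens !tmE tcons_left_tens !qprod1l.
Qed.

Lemma deconc1 : deconc one = one \ots one.
Proof. by rewrite deconc_pten split_sum_nil. Qed.

Lemma qprod2_1l X : (one \ots one) *_T X = X.
Proof.
move: X; apply: stens_eq => [||x y]; [exact: tmr|exact: lin_id|].
by rewrite tmE !qprod1l.
Qed.

Lemma qprod2C X Y : X *_T Y = Y *_T X.
Proof.
move: X; apply: stens_eq => [||x x']; [exact: tml|exact: tmr|].
move: Y; apply: stens_eq => [||y y']; [exact: tmr|exact: tml|].
by rewrite !tmE (qprodC x) (qprodC x').
Qed.

(** Induction on both words. In the product of [1 ⊗ au + (a ⊗ 1) Delta u] and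
    [1 ⊗ bv + (b ⊗ 1) Delta v], the first terms multiply to [1 ⊗ (au * bv)], and
    the others recombine by the recursion into the terms of [Delta (au * bv)] whose
    first factor starts with [a], [b] or [ab]. *)
Lemma deconcM x y : deconc (x ** y) = deconc x *_T deconc y.
Proof.
move: x; apply: tpow_eq => [||s].
- exact: lin_comp deconc_linear (shl y).
- exact: lin_comp (tml _) deconc_linear.
move: y; apply: tpow_eq => [||t].
- exact: lin_comp deconc_linear (shr _).
- exact: lin_comp (tmr _) deconc_linear.
elim: s t => [|a s IHs] t; first by rewrite qprod1l deconc1 qprod2_1l.
elim: t => [|b t IHt]; first by rewrite qprod1r deconc1 qprod2C qprod2_1l.
have E1 := IHs (b :: t); have E2 := IHs t.
rewrite -!tcons_pten in E1 E2 IHt *.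
move: (pten s) (pten t) E1 E2 IHt => {IHs}U V E1 E2 E3.
rewrite (deconc_tcons a U) (deconc_tcons b V).
rewrite (linD (tml _)) !(linD (tmr _)) tmE qprod1l.
rewrite qprod2_tcons_left1l qprod2_tcons_left1r qprod2_tcons_left.
rewrite qprod_tcons !(linD deconc_linear) (linZ deconc_linear) !deconc_tcons.
rewrite E1 E2 E3 (deconc_tcons a U) (deconc_tcons b V).
rewrite !(linD (tmr _)) !(linD (tml _)) !(linD (tcons_left_linear _)).
rewrite !(linD (stensr _)) !(linZ (stensr _)) scalerDr.
by rewrite [LHS](AC ((1*2)*(1*2)*2) ((1*4*7*5)*(2*(3*6*8)))).
Qed.

Let idl : linear (@id P). Proof. by []. Qed.

Let assocLl : linear (fun T : tensor P P => tassoc (tmap deconc id T)).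
Proof. exact: lin_comp (@tassoc_linear _ _ _ _) (tmap_linear deconc_linear idl). Qed.

Lemma tassoc_tcons_left a (D : tensor P P) (y : P) :
  tassoc (tcons_left a D \ox y) = tmap (tcons a) id (tassoc (D \ox y)).
Proof.
have acl := tmap_linear (tc a) (@lin_id k (tensor P P)).
move: D; apply: stens_eq => [||x x'].
- exact: lin_comp (@tassoc_linear _ _ _ _) (lin_comp (tensl y) (tcons_left_linear a)).
- exact: lin_comp acl (lin_comp (@tassoc_linear _ _ _ _) (tensl y)).
rewrite tcons_left_tens !stensE; apply: etrans (tassoc_tens (tcons a x) x' y) _.
apply: etrans _ (congr1 (tmap (tcons a) id) (esym (tassoc_tens x x' y))).
exact: esym (tmap_tens (tc a) (@lin_id k (tensor P P)) x (x' \ox y)).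
Qed.

Lemma tassoc_deconc_tcons_left a (T : tensor P P) :
  tassoc (tmap deconc id (tcons_left a T)) =
  one \ox tcons_left a T + tmap (tcons a) id (tassoc (tmap deconc id T)).
Proof.
have acl := tmap_linear (tc a) (@lin_id k (tensor P P)).
move: T; apply: stens_eq => [||x y].
- exact: lin_comp assocLl (tcons_left_linear a).
- apply: lin_add; first exact: lin_comp (tensr one) (tcons_left_linear a).
  exact: lin_comp acl assocLl.
have E u := tmap_tens deconc_linear idl u y.
rewrite tcons_left_tens !stensE.
apply: etrans (congr1 (@tassoc _ _ _ _) (E (tcons a x))) _.
apply: etrans (congr1 (fun z => tassoc (z \ox y)) (deconc_tcons a x)) _.
apply: etrans (congr1 (@tassoc _ _ _ _) (linD (tensl y) _ _)) _.
apply: etrans (linD (@tassoc_linear _ _ _ _) _ _) _.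
congr (_ + _); first by rewrite stensE; exact: tassoc_tens.
apply: etrans (tassoc_tcons_left a (deconc x) y) _.
congr (tmap _ _ (tassoc _)); exact: esym (E x).
Qed.

Lemma tmap_deconc_tcons_left a (T : tensor P P) :
  tmap id deconc (tcons_left a T) = tmap (tcons a) id (tmap id deconc T).
Proof.
rewrite /tcons_left -lock (tmap_comp T idl (tc a) deconc_linear idl).
by rewrite (tmap_comp T (tc a) idl (@lin_id _ _) deconc_linear).
Qed.

(** Both sides satisfy the same recursion when a letter is prepended. *)
Lemma deconcA x : tassoc (tmap deconc id (deconc x)) = tmap id deconc (deconc x).
Proof.
have iDl := tmap_linear idl deconc_linear.
move: x; apply: tpow_eq => [||s].
- exact: lin_comp assocLl deconc_linear.
- exact: lin_comp iDl deconc_linear.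
elim: s => [|a s IH].
  rewrite [X in tmap deconc id X]deconc1 [X in tmap id deconc X]deconc1 stensE.
  apply: etrans (congr1 (@tassoc _ _ _ _) (tmap_tens deconc_linear idl one one)) _.
  apply: etrans _ (esym (tmap_tens idl deconc_linear one one)).
  by rewrite deconc1 stensE; exact: tassoc_tens.
rewrite -tcons_pten; move: (pten s) IH => x IH.
have E : tmap id deconc (deconc (tcons a x)) =
    one \ox deconc (tcons a x) + tmap (tcons a) id (tmap id deconc (deconc x)).
  rewrite [X in tmap id deconc X]deconc_tcons (linD iDl) tmap_deconc_tcons_left stensE.
  by congr (_ + _); exact: (tmap_tens idl deconc_linear one (tcons a x)).
rewrite E -IH [X in one \ox X]deconc_tcons (linD (tensr one)) stensE -addrA.
apply: etrans _ (congr1 (+%R (one \ox (one \ox tcons a x)))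
  (tassoc_deconc_tcons_left a (deconc x))).
apply: etrans (congr1 (fun X => tassoc (tmap deconc id X)) (deconc_tcons a x)) _.
apply: etrans (linD assocLl _ _) _; congr (_ + _); rewrite stensE.
apply: etrans (congr1 (@tassoc _ _ _ _) (tmap_tens deconc_linear idl one _)) _.
by rewrite deconc1 stensE; exact: tassoc_tens.
Qed.

Lemma tlift_deconc (Z : lmodType k) (m : P -> P -> Z) s : is_bilinear m ->
  tlift m (deconc (pten s)) = split_sum m pten pten s.
Proof.
move=> mb; rewrite deconc_pten /split_sum (lin_sum (tlift_linear mb)).
by apply: eq_bigr => i _; rewrite stensE tlift_tens.
Qed.

Lemma deconc_counitl x : tlift (fun y z => counit y *: z) (deconc x) = x.
Proof.
have eb := @scale_bilinearl k P P counit counit_linear.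
move: x; apply: tpow_eq => [||s]; [|exact: lin_id|].
  exact: lin_comp (tlift_linear eb) deconc_linear.
rewrite (tlift_deconc _ eb); case: s => [|a s].
  by rewrite split_sum_nil counit_pten scale1r.
rewrite split_sum_cons counit_pten scale1r /split_sum big1 ?addr0 // => i _.
by rewrite counit_pten scale0r.
Qed.

Lemma deconc_counitr x : tlift (fun y z => counit z *: y) (deconc x) = x.
Proof.
have eb := @scale_bilinearr k P P counit counit_linear.
move: x; apply: tpow_eq => [||s]; [|exact: lin_id|].
  exact: lin_comp (tlift_linear eb) deconc_linear.
rewrite (tlift_deconc _ eb) /split_sum big_ord_recr /= drop_size take_size.
rewrite counit_pten scale1r big1 ?add0r // => i _; rewrite counit_pten.
case E: (drop i s) => [|b t]; last by rewrite scale0r.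
by have /esym/eqP := size_drop i s; rewrite E subn_eq0 leqNgt ltn_ord.
Qed.

(** * The antipode *)

(** Functions on words rather than linear maps are convolved: associativity then
    is an induction on the word that varies the functions. *)
Local Notation conv := (split_sum (@qprod B lam)).
Implicit Types F G H : seq B -> P.

Let conv_ext F F' G G' : F =1 F' -> G =1 G' -> conv F G =1 conv F' G'.
Proof. by move=> E E' s; apply: eq_bigr => i _; rewrite E E'. Qed.

Lemma convA F G H s : conv (conv F G) H s = conv F (conv G H) s.
Proof.
elim: s F G H => [|a s IH] F G H; first by rewrite !split_sum_nil -qprodA.
rewrite !split_sum_cons !split_sum_nil (linD (shr _)) -IH qprodA -!addrA.
congr (_ + _).
have -> : conv (fun t => conv F G (a :: t)) H s =
    conv (fun t => F [::] ** G (a :: t) + conv (fun t => F (a :: t)) G t) H s.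
  by apply: conv_ext => // t; rewrite split_sum_cons.
rewrite /split_sum (lin_sum (shr _)) -big_split; apply: eq_bigr => i _ /=.
by rewrite (linD (shl _)) qprodA.
Qed.

Definition conv_unit (s : seq B) : P := if s is [::] then one else 0.
Definition pten_plus (s : seq B) : P := if s is [::] then 0 else pten s.

Let qprod0l x : 0 ** x = 0. Proof. exact: lin0 (shl x). Qed.
Let qprod0r x : x ** 0 = 0. Proof. exact: lin0 (shr x). Qed.

Lemma conv_unitl F s : conv conv_unit F s = F s.
Proof.
case: s => [|a s]; first by rewrite split_sum_nil qprod1l.
rewrite split_sum_cons qprod1l /split_sum big1 ?addr0 // => i _; exact: qprod0l.
Qed.

Lemma conv_unitr F s : conv F conv_unit s = F s.
Proof.
rewrite /split_sum big_ord_recr /= drop_size take_size qprod1r big1 ?add0r // => i _.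
case E: (drop i s) => [|b t]; last by rewrite qprod0r.
by have /esym/eqP := size_drop i s; rewrite E subn_eq0 leqNgt ltn_ord.
Qed.

(** The convolution powers of [id - eta epsilon]. They vanish on words shorter
    than the exponent, so the geometric series for the convolution inverse of the
    identity is finite on each word. *)
Fixpoint conv_pow j : seq B -> P :=
  if j is j'.+1 then conv pten_plus (conv_pow j') else conv_unit.

Lemma conv_powSr j s : conv_pow j.+1 s = conv (conv_pow j) pten_plus s.
Proof.
elim: j s => [|j IH] s; first by rewrite /= conv_unitr conv_unitl.
by rewrite [LHS]/= (conv_ext (frefl _) IH) -convA.
Qed.

Lemma conv_pow_small j s : (size s < j)%N -> conv_pow j s = 0.
Proof.
elim: j s => // j IH s ltj; rewrite /= /split_sum big1 // => i _.
case: s ltj i => [|a s] ltj [[|i] lti] /=; rewrite ?qprod0l //.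
rewrite IH ?qprod0r // size_drop; apply: leq_ltn_trans (leq_subr _ _) _.
exact: ltj.
Qed.

(** The number of summands depends on the length of the word only; this keeps
    the definition multilinear. *)
Definition anti_word (s : seq B) : P :=
  \sum_(j < (size s).+1) (-1) ^+ j *: conv_pow j s.

Lemma anti_wordE n s : (size s <= n)%N ->
  anti_word s = \sum_(j < n.+1) (-1) ^+ j *: conv_pow j s.
Proof.
move=> le_sn; rewrite /anti_word
  (big_ord_widen n.+1 (fun j => (-1) ^+ j *: conv_pow j s)) //.
rewrite big_mkcond; apply: eq_bigr => j _; case: ltnP => // ltj.
by rewrite conv_pow_small ?scaler0.
Qed.

Let pten_split s : pten s = pten_plus s + conv_unit s.
Proof. by case: s => [|a s]; rewrite /= ?add0r ?addr0. Qed.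

Lemma conv_anti_l s : conv anti_word pten s = conv_unit s.
Proof.
have -> : conv anti_word pten s =
    \sum_(j < (size s).+1) (-1) ^+ j *: (conv_pow j.+1 s + conv_pow j s).
  transitivity (\sum_(j < (size s).+1) (-1) ^+ j *: conv (conv_pow j) pten s).
    under [RHS]eq_bigr do rewrite scaler_sumr.
    rewrite exchange_big; apply: eq_bigr => i _ /=.
    rewrite (@anti_wordE (size s)) ?size_take_min ?geq_minr //.
    by rewrite (lin_sum (shl _)); apply: eq_bigr => j _; rewrite (linZ (shl _)).
  apply: eq_bigr => j _; congr (_ *: _); rewrite conv_powSr.
  rewrite -[X in _ + X]conv_unitr -big_split; apply: eq_bigr => i _ /=.
  by rewrite {1}pten_split (linD (shr _)).
rewrite (alt_telescope (fun j => conv_pow j s)) [X in _ *: X]conv_pow_small //.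
by rewrite scaler0 addr0.
Qed.

Lemma conv_anti_r s : conv pten anti_word s = conv_unit s.
Proof.
have -> : conv pten anti_word s =
    \sum_(j < (size s).+1) (-1) ^+ j *: (conv_pow j.+1 s + conv_pow j s).
  transitivity (\sum_(j < (size s).+1) (-1) ^+ j *: conv pten (conv_pow j) s).
    under [RHS]eq_bigr do rewrite scaler_sumr.
    rewrite exchange_big; apply: eq_bigr => i _ /=.
    rewrite (@anti_wordE (size s)) ?size_drop ?leq_subr //.
    by rewrite (lin_sum (shr _)); apply: eq_bigr => j _; rewrite (linZ (shr _)).
  apply: eq_bigr => j _; congr (_ *: _).
  rewrite -[X in _ + X]conv_unitl -big_split; apply: eq_bigr => i _ /=.
  by rewrite {1}pten_split (linD (shl _)).
rewrite (alt_telescope (fun j => conv_pow j s)) [X in _ *: X]conv_pow_small //.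
by rewrite scaler0 addr0.
Qed.

Lemma conv_pow_multilinear j : multilinear (conv_pow j).
Proof.
elim: j => [|j IH] /=.
  by move=> [|? ?] t c x y; rewrite /= scaler0 addr0.
apply: split_sum_multilinear => // s t c x y.
case: s => [|b s]; first exact: (@pten_multilinear k B [::] t c x y).
exact: (@pten_multilinear k B (b :: s) t c x y).
Qed.

Lemma anti_word_multilinear : multilinear anti_word.
Proof.
move=> s t c x y; rewrite /anti_word !size_cat /=.
rewrite scaler_sumr -big_split; apply: eq_bigr => j _ /=.
by rewrite conv_pow_multilinear scalerDr !scalerA mulrC.
Qed.

Definition antipode : P -> P := locked (tplift anti_word).

Lemma antipode_linear : linear antipode.
Proof. by rewrite /antipode -lock; exact: tplift_linear anti_word_multilinear. Qed.

Lemma antipode_pten s : antipode (pten s) = anti_word s.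
Proof. by rewrite /antipode -lock; exact: tplift_pten anti_word_multilinear s. Qed.

Let Sl := antipode_linear.

Let antil_bilinear : is_bilinear (fun y z => antipode y ** z).
Proof.
by split=> [z|y]; [exact: lin_comp (shl z) Sl | exact: shr].
Qed.
Let antir_bilinear : is_bilinear (fun y z => y ** antipode z).
Proof.
by split=> [z|y]; [exact: shl | exact: lin_comp (shr y) Sl].
Qed.

Let counit_one_linear : linear (fun x => counit x *: one).
Proof. by move=> c x y; rewrite counit_linear scalerDl scalerA. Qed.

Lemma antipodel x : tlift (fun y z => antipode y ** z) (deconc x) = counit x *: one.
Proof.
move: x; apply: tpow_eq => [||s]; [|exact: counit_one_linear|].
  exact: lin_comp (tlift_linear antil_bilinear) deconc_linear.
rewrite (tlift_deconc _ antil_bilinear) counit_pten.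
transitivity (conv anti_word pten s).
  by apply: eq_bigr => i _; rewrite antipode_pten.
by rewrite conv_anti_l; case: s => [|a s]; rewrite ?scale1r ?scale0r.
Qed.

Lemma antipoder x : tlift (fun y z => y ** antipode z) (deconc x) = counit x *: one.
Proof.
move: x; apply: tpow_eq => [||s]; [|exact: counit_one_linear|].
  exact: lin_comp (tlift_linear antir_bilinear) deconc_linear.
rewrite (tlift_deconc _ antir_bilinear) counit_pten.
transitivity (conv pten anti_word s).
  by apply: eq_bigr => i _; rewrite antipode_pten.
by rewrite conv_anti_r; case: s => [|a s]; rewrite ?scale1r ?scale0r.
Qed.

Lemma qprodACA x y z u : (x ** y) ** (z ** u) = (x ** z) ** (y ** u).
Proof. by rewrite -!qprodA [y ** (z ** u)]qprodA (qprodC y z) -(qprodA z). Qed.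

(** By induction on the total length. Applying the antipode axiom to [s * t] and
    to [s] and [t] separately gives two sums over pairs of cuts with the same value.
    They agree term by term, by induction, except for the cuts at both ends, whose
    terms are the two sides of the claim. *)
Let antipodeM_words s t :
  antipode (pten s ** pten t) = antipode (pten s) ** antipode (pten t).
Proof.
have [n] := ubnP (size s + size t)%N; elim: n s t => // n IH s t; rewrite ltnS => le_n.
have sumE (S2 : P -> P -> P) :
  \sum_(i < (size s).+1) \sum_(j < (size t).+1)
    S2 (pten (take i s)) (pten (take j t)) ** (pten (drop i s) ** pten (drop j t)) =
  (\sum_(i < size s) \sum_(j < (size t).+1)
    S2 (pten (take i s)) (pten (take j t)) ** (pten (drop i s) ** pten (drop j t))
   + \sum_(j < size t)
    S2 (pten s) (pten (take j t)) ** pten (drop j t))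
   + S2 (pten s) (pten t).
  rewrite big_ord_recr /= -addrA; congr (_ + _); rewrite big_ord_recr /=.
  rewrite !drop_size !take_size !qprod1r; congr (_ + _).
  by apply: eq_bigr => j _; rewrite qprod1l.
have L : \sum_(i < (size s).+1) \sum_(j < (size t).+1)
    antipode (pten (take i s) ** pten (take j t)) **
      (pten (drop i s) ** pten (drop j t)) = counit (pten s) * counit (pten t) *: one.
  rewrite -counitM -antipodel deconcM !deconc_pten /split_sum.
  rewrite (lin_sum (tml _)) (lin_sum (tlift_linear antil_bilinear)).
  apply: eq_bigr => i _.
  rewrite (lin_sum (tmr _)) (lin_sum (tlift_linear antil_bilinear)).
  by apply: eq_bigr => j _; rewrite tmE stensE tlift_tens.
have R : \sum_(i < (size s).+1) \sum_(j < (size t).+1)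
    (antipode (pten (take i s)) ** antipode (pten (take j t))) **
      (pten (drop i s) ** pten (drop j t)) = counit (pten s) * counit (pten t) *: one.
  rewrite -scalerA -[one in RHS]qprod1l -(linZ (shr _)) -(linZ (shl _)).
  rewrite -!antipodel !(tlift_deconc _ antil_bilinear).
  rewrite /split_sum (lin_sum (shl _)); apply: eq_bigr => i _.
  by rewrite (lin_sum (shr _)); apply: eq_bigr => j _; rewrite qprodACA.
move: L; rewrite -R (sumE (fun x y => antipode (x ** y))).
rewrite (sumE (fun x y => antipode x ** antipode y)).
have lt_take i (r : seq B) : (i < size r)%N -> (size (take i r) < size r)%N.
  by move=> lt; rewrite size_take_min (leq_ltn_trans (geq_minl _ _)).
rewrite (_ : \sum_(i < size s) _ = \sum_(i < size s) \sum_(j < (size t).+1)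
    (antipode (pten (take i s)) ** antipode (pten (take j t))) **
      (pten (drop i s) ** pten (drop j t))); last first.
  apply: eq_bigr => i _; apply: eq_bigr => j _; rewrite IH //.
  apply: leq_trans le_n; rewrite -addSn leq_add ?lt_take //.
  by rewrite size_take_min geq_minr.
rewrite (_ : \sum_(j < size t) _ = \sum_(j < size t)
    (antipode (pten s) ** antipode (pten (take j t))) ** pten (drop j t)).
  by move/addrI.
apply: eq_bigr => j _; rewrite IH //.
by apply: leq_trans le_n; rewrite -addnS leq_add ?lt_take.
Qed.

Lemma antipodeM x y : antipode (x ** y) = antipode x ** antipode y.
Proof.
move: x; apply: tpow_eq => [||s].
- exact: lin_comp Sl (shl y).
- exact: lin_comp (shl _) Sl.
move: y; apply: tpow_eq => [||t].
- exact: lin_comp Sl (shr _).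
- exact: lin_comp (shr _) Sl.
exact: antipodeM_words.
Qed.

Lemma qprod2E : qprod2 = tmul (@qprod B lam) (@qprod B lam).
Proof. by rewrite /qprod2 -lock. Qed.

Definition qshuffle_hopf : hopfAlg P.
Proof.
refine (@HopfAlg k P (@qprod B lam) one deconc counit antipode qprod_bilinear
  _ _ _ _ _ _ _ _ _ _ _ _ _ _ _).
- exact: qprodA.
- exact: qprod1l.
- exact: qprod1r.
- exact: deconc_linear.
- exact: counit_linear.
- exact: antipode_linear.
- exact: deconcA.
- exact: deconc_counitl.
- exact: deconc_counitr.
- by move=> x y; rewrite deconcM qprod2E.
- by rewrite deconc1 stensE.
- exact: counitM.
- by rewrite counit_pten.
- exact: antipodel.
- exact: antipoder.
Defined.

End QuasiShuffle.

(** * Twisting by a character *)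

Section Twist.
Context {k : fieldType}.
Variables (B : comNuAlg k) (lam : k) (f : B -> k).
Hypotheses (fl : scalar f) (fM : forall a b, f (numul a b) = f a * f b).
Local Notation P := (tpow B).
Local Notation one := (pten [::] : P).
Local Notation "x ** y" := (@qprod k B lam x y) (at level 40, left associativity).

Let tc a : linear (@tcons k B a). Proof. exact: tcons_linear. Qed.
Let shl y : linear (fun x => x ** y). Proof. exact: (qprod_bilinear B lam).1. Qed.
Let shr x : linear (fun y => x ** y). Proof. exact: (qprod_bilinear B lam).2. Qed.

(** [1 + lam D], where [D] removes the first letter [a] and multiplies by [f a]. *)
Definition twist_word (s : seq B) : P :=
  if s is a :: t then pten s + (lam * f a) *: pten t else pten [::].

(** The inverse is the series of the [(- lam D)^j], which stops on each word. *)
Fixpoint untwist_word (s : seq B) : P :=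
  if s is a :: t then pten s - (lam * f a) *: untwist_word t else pten [::].

Lemma twist_word_multilinear : multilinear twist_word.
Proof.
move=> s t; case: s => [|b s] /=; last first.
  apply: lin_add; first exact: (@pten_multilinear k B (b :: s) t).
  apply: lin_scale; exact: (@pten_multilinear k B s t).
apply: lin_add; first exact: (@pten_multilinear k B [::] t).
by move=> c x y; rewrite fl mulrDr scalerDl mulrCA scalerA.
Qed.

Lemma untwist_word_multilinear : multilinear untwist_word.
Proof.
elim=> [|b s IH] t /=.
  apply: lin_add; first exact: (@pten_multilinear k B [::] t).
  move=> c x y; rewrite fl mulrDr scalerDl mulrCA scalerN scalerA opprD //.
apply: lin_add; first exact: (@pten_multilinear k B (b :: s) t).
move=> c x y; rewrite IH scalerDr opprD !scalerA mulrC -!scalerA scalerN //.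
Qed.

Definition twist : P -> P := locked (tplift twist_word).
Definition untwist : P -> P := locked (tplift untwist_word).

Lemma twist_linear : linear twist.
Proof. by rewrite /twist -lock; exact: tplift_linear twist_word_multilinear. Qed.
Lemma untwist_linear : linear untwist.
Proof. by rewrite /untwist -lock; exact: tplift_linear untwist_word_multilinear. Qed.
Lemma twist_pten s : twist (pten s) = twist_word s.
Proof. by rewrite /twist -lock; exact: tplift_pten twist_word_multilinear s. Qed.
Lemma untwist_pten s : untwist (pten s) = untwist_word s.
Proof. by rewrite /untwist -lock; exact: tplift_pten untwist_word_multilinear s. Qed.

Lemma twist1 : twist one = one. Proof. exact: twist_pten. Qed.
Lemma untwist1 : untwist one = one. Proof. exact: untwist_pten. Qed.

Lemma twist_tcons a x : twist (tcons a x) = tcons a x + (lam * f a) *: x.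
Proof.
move: x; apply: tpow_eq => [||s].
- exact: lin_comp twist_linear (tc a).
- by apply: lin_add; [exact: tc | apply: lin_scale; exact: lin_id].
- by rewrite tcons_pten twist_pten.
Qed.

Lemma untwist_tcons a x :
  untwist (tcons a x) = tcons a x - (lam * f a) *: untwist x.
Proof.
rewrite -scaleNr; move: x; apply: tpow_eq => [||s].
- exact: lin_comp untwist_linear (tc a).
- by apply: lin_add; [exact: tc | apply: lin_scale; exact: untwist_linear].
- by rewrite tcons_pten !untwist_pten scaleNr.
Qed.

Lemma twistK : cancel twist untwist.
Proof.
apply: tpow_eq => [||s]; [exact: lin_comp untwist_linear twist_linear|exact: lin_id|].
case: s => [|a s]; first by rewrite twist1 untwist1.
rewrite -tcons_pten twist_tcons (linD untwist_linear) (linZ untwist_linear).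
by rewrite untwist_tcons subrK.
Qed.

Lemma untwistK : cancel untwist twist.
Proof.
apply: tpow_eq => [||s]; [exact: lin_comp twist_linear untwist_linear|exact: lin_id|].
elim: s => [|a s IH]; first by rewrite untwist1 twist1.
rewrite -tcons_pten untwist_tcons (linB twist_linear) (linZ twist_linear).
by rewrite IH twist_tcons addrK.
Qed.

(** Removing the first letter of [au * bv] gives
    [f a (u * bv) + f b (au * v) + lam (f a f b) (u * v)], by the recursion and
    multiplicativity of [f]. The last term is what makes [1 + lam D]
    multiplicative. *)
Lemma twistM x y : twist (x ** y) = twist x ** twist y.
Proof.
move: x; apply: tpow_eq => [||s].
- exact: lin_comp twist_linear (shl y).
- exact: lin_comp (shl _) twist_linear.
move: y; apply: tpow_eq => [||t].
- exact: lin_comp twist_linear (shr _).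
- exact: lin_comp (shr _) twist_linear.
case: s => [|a s]; first by rewrite twist1 !qprod1l.
case: t => [|b t]; first by rewrite twist1 !qprod1r.
rewrite -!tcons_pten; move: (pten s) (pten t) => U V.
rewrite (twist_tcons a U) (twist_tcons b V) (linD (shl _)) !(linD (shr _)).
rewrite !(linZ (shl _)) !(linZ (shr _)) qprod_tcons.
rewrite !(linD twist_linear) (linZ twist_linear) !twist_tcons fM scalerDr !scalerA.
rewrite (_ : lam * f a * (lam * f b) = lam * (lam * (f a * f b))); last first.
  by rewrite -!mulrA; congr (_ * _); rewrite mulrCA.
by rewrite [LHS](AC (2*2*2) ((1*3*5)*4*(2*6))).
Qed.

Lemma untwistM x y : untwist (x ** y) = untwist x ** untwist y.
Proof. by apply: (can_inj twistK); rewrite twistM !untwistK. Qed.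

(** Removing the first letter commutes with cutting the word, except for the cut
    before the first letter, whose left part is empty. *)
Lemma deconc_twist x : deconc (twist x) = tmap twist id (deconc x).
Proof.
have dl := @deconc_linear k B; have idl : linear (@id P) by [].
have tl := tmap_linear twist_linear idl.
move: x; apply: tpow_eq => [||s].
- exact: lin_comp dl twist_linear.
- exact: lin_comp tl dl.
case: s => [|a s].
  rewrite twist1 deconc1 stensE; apply: esym.
  by apply: etrans (tmap_tens twist_linear idl one one) _; rewrite twist1.
rewrite -tcons_pten; move: (pten s) => x.
rewrite twist_tcons (linD dl) (linZ dl) (deconc_tcons a x) (linD tl) stensE -addrA.
congr (_ + _).
  by apply: esym; apply: etrans (tmap_tens twist_linear idl one _) _; rewrite twist1.
move: (deconc x); apply: stens_eq => [||y z].
- apply: lin_add; last by apply: lin_scale; exact: lin_id.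
  by rewrite /tcons_left -lock; exact: tmap_linear (tc a) idl.
- apply: lin_comp tl _.
  by rewrite /tcons_left -lock; exact: tmap_linear (tc a) idl.
have E : tcons_left a (y \ox z) = tcons a y \ox z.
  by rewrite /tcons_left -lock; exact: tmap_tens (tc a) idl y z.
rewrite stensE E; apply: esym; apply: etrans (tmap_tens twist_linear idl _ _) _.
by rewrite twist_tcons (linD (tensl z)) (linZ (tensl z)).
Qed.

Let idT (V : lmodType k) (t : tensor V V) (g : V -> V) :
  g =1 id -> tmap g g t = t.
Proof. by move=> gE; rewrite (_ : g = id) ?tmap_id //; apply/funext. Qed.

(** The deconcatenation structure, conjugated by [twist]. *)
Definition twisted_hopf : hopfAlg P :=
  hopf_transport (h := qshuffle_hopf B lam) twist_linear untwist_linear twistK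
    (untwistK _) (fun x y => untwistK _) (fun x => idT _ untwistK)
    (fun x => untwistK _).

Lemma twisted_mulE x y : hpmul twisted_hopf x y = x ** y.
Proof. by rewrite /= /pull_mul /= -twistM twistK. Qed.

Lemma twisted_oneE : hpone twisted_hopf = one.
Proof. exact: untwist1. Qed.

(** One of the two inverse twists cancels against the twist produced by
    [deconc_twist]. *)
Lemma twisted_comulE x : hpcomul twisted_hopf x = tmap id untwist (deconc x).
Proof.
have idl : linear (@id P) by [].
rewrite /= /pull_comul /= deconc_twist.
rewrite (tmap_comp _ untwist_linear twist_linear untwist_linear idl).
by rewrite (_ : untwist \o twist = id) //; apply/funext => y; exact: twistK.
Qed.

Lemma twisted_counitE x : hpcounit twisted_hopf x = counit (twist x).
Proof. by []. Qed.

Lemma twisted_antiE x : hpanti twisted_hopf x = untwist (antipode lam (twist x)).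
Proof. by []. Qed.

Lemma twisted_antiM x y : hpanti twisted_hopf (x ** y) =
  hpanti twisted_hopf x ** hpanti twisted_hopf y.
Proof. by rewrite !twisted_antiE twistM antipodeM untwistM. Qed.

End Twist.

Section TwistedStructure.
Context {k : fieldType}.
Variables (B : comNuAlg k) (lam : k) (f : B -> k).
Hypotheses (fl : scalar f) (fM : forall a b, f (numul a b) = f a * f b).

Lemma untwist_nseq u n : f u = 1 -> untwist lam f (pten (nseq n u)) =
  \sum_(j < n.+1) (- lam) ^+ j *: pten (nseq (n - j) u).
Proof.
move=> fu; elim: n => [|n IH]; first by rewrite big_ord1 scale1r untwist1.
rewrite -tcons_pten (untwist_tcons lam fl) IH tcons_pten fu mulr1 -scaleNr.
rewrite [RHS]big_ord_recl scale1r; congr (_ + _).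
by rewrite scaler_sumr; apply: eq_bigr => j _; rewrite scalerA -exprS.
Qed.

Lemma untwist_fixed (T : Type) (g : T -> B) s : (forall x, f (g x) = 0) ->
  untwist lam f (pten (map g s)) = pten (map g s).
Proof.
move=> fg; rewrite (untwist_pten lam fl); case: s => //= x s.
by rewrite fg mulr0 scale0r subr0.
Qed.

Let idl : linear (@id (tpow B)). Proof. by []. Qed.
Let untl : linear (untwist lam f). Proof. exact: untwist_linear. Qed.

Lemma twisted_comul_pten s : hpcomul (twisted_hopf lam fl) (pten s) =
  \sum_(i < (size s).+1) pten (take i s) \ox untwist lam f (pten (drop i s)).
Proof.
rewrite twisted_comulE deconc_pten /split_sum (lin_sum (tmap_linear idl untl)).
by apply: eq_bigr => i _; rewrite stensE; exact: tmap_tens idl untl _ _.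
Qed.

(** Cutting the word after [i] letters and applying [untwist] to the right part gives
    the terms with [j <= n - i]; the two summations are then exchanged. *)
Lemma twisted_agko u : f u = 1 ->
  agko_structure (twisted_hopf lam fl) lam (fun n => pten (nseq n u)).
Proof.
move=> fu; split=> n.
  rewrite twisted_comul_pten size_nseq.
  transitivity (\sum_(i < n.+1) \sum_(j < n.+1 | (i + j <= n)%N)
      (- lam) ^+ j *: (pten (nseq i u) \ox pten (nseq (n - i - j) u))).
    apply: eq_bigr => i _; have le_in : (i <= n)%N by rewrite -ltnS.
    rewrite take_nseq // drop_nseq untwist_nseq //.
    rewrite (lin_sum (tensr _)).
    rewrite (big_ord_widen n.+1 (fun j =>
      pten (nseq i u) \ox ((- lam) ^+ j *: pten (nseq (n - i - j) u)))); last first.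
      by rewrite ltnS leq_subr.
    apply: eq_big => [j|j _]; first by rewrite ltnS leq_subRL.
    exact: linZ (tensr _) _ _.
  rewrite (exchange_big_dep predT) //=; apply: eq_bigr => j _.
  have le_jn : (j <= n)%N by rewrite -ltnS.
  rewrite (big_ord_widen n.+1 (fun i => (- lam) ^+ j *:
     (pten (nseq i u) \ox pten (nseq (n - j - i) u)))); last first.
    by rewrite ltnS leq_subr.
  apply: eq_big => [i|i _]; first by rewrite ltnS leq_subRL // addnC.
  by rewrite subnAC.
rewrite twisted_counitE.
have counitl : linear (@counit k B : _ -> k^o) := @counit_linear k B.
case: n => [|n]; first by rewrite (twist1 lam fl) counit_pten.
rewrite -tcons_pten (twist_tcons lam fl) (linD counitl) (linZ counitl).
rewrite counit_tcons counit_pten.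
rewrite fu mulr1 add0r.
by case: n => [|n]; rewrite ?scaler0 // [LHS]mulr1.
Qed.

Lemma twisted_deconcatenation (T : Type) (g : T -> B) : (forall x, f (g x) = 0) ->
  deconcatenation_structure (twisted_hopf lam fl) (fun s => pten (map g s)).
Proof.
move=> fg; split=> s.
  rewrite twisted_comul_pten size_map; apply: eq_bigr => i _.
  by rewrite -map_take -map_drop untwist_fixed.
rewrite twisted_counitE.
rewrite -[X in twist _ _ X](untwist_fixed s fg) (untwistK lam fl) counit_pten.
by case: s.
Qed.

End TwistedStructure.

(** * Hopf subalgebras and functoriality *)
Section Range.
Context {k : fieldType}.

Lemma tensor_span (V W : lmodType k) (t : tensor V W) :
  t \in Defs.span [set v \ox w | v in [set: V] & w in [set: W]].
Proof.
rewrite -[t]preprK (monalgE (prepr t)).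
elim/big_ind: _ => [||u _].
- have /= := @pprojB k _ (@tensor_rel k V W) 0 0; rewrite !subrr => ->; exact: rpred0.
- by move=> x y; rewrite pprojD; exact: rpredD.
have -> : << (prepr t)@_u *g u >> = (prepr t)@_u *: << u >>.
  by apply/malgP => v; rewrite mcoeffZ !mcoeffU mulrnAr mulr1.
rewrite pprojZ; apply: rpredZ; apply: mem_span; exists u.1 => //; exists u.2 => //.
by case: u.
Qed.

Lemma tmap_tensor_set (V V' : lmodType k) (A : set V) (A' : set V')
    (g : V -> V') t :
  linear g -> (forall x, A x -> A' (g x)) ->
  tensor_set A A t -> tensor_set A' A' (tmap g g t).
Proof.
move=> gl gA tA; have ggl := tmap_linear gl gl.
change (tmap g g t \in Defs.span [set a \ox b | a in A' & b in A']).
move: t tA; apply: span_ind; first by rewrite (lin0 ggl) rpred0.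
move=> c _ y [a Aa [b Ab <-]] Py; rewrite ggl (tmap_tens gl gl).
apply: rpredD => //; apply: rpredZ; apply: mem_span.
by exists (g a); [exact: gA|exists (g b); [exact: gA|]].
Qed.

Lemma range_hopf_subalgebra (H H' : lmodType k) (h : hopfAlg H)
    (h' : hopfAlg H') (g : H' -> H) :
  linear g -> g (hpone h') = hpone h ->
  (forall x y, g (hpmul h' x y) = hpmul h (g x) (g y)) ->
  (forall x, hpcomul h (g x) = tmap g g (hpcomul h' x)) ->
  (forall x, hpanti h (g x) = g (hpanti h' x)) ->
  hopf_subalgebra h (range g).
Proof.
move=> gl g1 gM gD gS; split.
- by exists (hpone h').
- by move=> c _ _ [x _ <-] [y _ <-]; exists (c *: x + y); rewrite // gl.
- by move=> _ _ [x _ <-] [y _ <-]; exists (hpmul h' x y); rewrite // gM.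
- move=> _ [x _ <-]; rewrite gD; apply: (tmap_tensor_set gl) (tensor_span _).
  by move=> y _; exists y.
- by move=> _ [x _ <-]; exists (hpanti h' x); rewrite // gS.
Qed.

End Range.

Section Functoriality.
Context {k : fieldType}.
Variables (B B' : comNuAlg k) (lam : k) (g : B' -> B) (f : B -> k).
Hypotheses (gl : linear g) (gM : forall a b, g (numul a b) = numul (g a) (g b)).
Hypotheses (fl : scalar f) (fM : forall a b, f (numul a b) = f a * f b).

Let G : tpow B' -> tpow B := tpmap g.

Lemma tpmap_linear : linear (tpmap g).
Proof.
apply: tplift_linear => s t c x y.
by rewrite !map_cat /= gl pten_multilinear.
Qed.

Let GE s : G (pten s) = pten (map g s). Proof. exact: tpmap_pten. Qed.
Let Gl : linear G. Proof. exact: tpmap_linear. Qed.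

Lemma tpmap_tcons a x : tpmap g (tcons a x) = tcons (g a) (tpmap g x).
Proof.
rewrite -/(G _) -/(G x); move: x; apply: tpow_eq => [||s].
- exact: lin_comp Gl (@tcons_linear _ _ _).
- exact: lin_comp (@tcons_linear _ _ _) Gl.
- by rewrite tcons_pten !GE tcons_pten.
Qed.

Let shl (C : comNuAlg k) y : linear (fun x => @qprod k C lam x y).
Proof. exact: (qprod_bilinear C lam).1. Qed.
Let shr (C : comNuAlg k) x : linear (fun y => @qprod k C lam x y).
Proof. exact: (qprod_bilinear C lam).2. Qed.

Lemma tpmapM x y : tpmap g (qprod lam x y) = qprod lam (tpmap g x) (tpmap g y).
Proof.
rewrite -!/(G _); move: x; apply: tpow_eq => [||s].
- exact: lin_comp Gl (shl y).
- exact: lin_comp (shl _) Gl.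
move: y; apply: tpow_eq => [||t].
- exact: lin_comp Gl (shr _).
- exact: lin_comp (shr _) Gl.
have G1 : G (pten [::]) = pten [::] by rewrite GE.
elim: s t => [|a s IHs] t; first by rewrite G1 !qprod1l.
elim: t => [|b t IHt]; first by rewrite G1 !qprod1r.
have E1 := IHs (b :: t); have E2 := IHs t; rewrite -!tcons_pten in E1 E2 IHt *.
rewrite qprod_tcons !(linD Gl) (linZ Gl) ![G (tcons _ _)]tpmap_tcons -!/(G _).
rewrite E1 E2 IHt ![G (tcons _ _)]tpmap_tcons -!/(G _) qprod_tcons gM.
by [].
Qed.

Lemma deconc_tpmap x : deconc (tpmap g x) = tmap (tpmap g) (tpmap g) (deconc x).
Proof.
have GGl := tmap_linear Gl Gl; rewrite -!/G -/(G x).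
move: x; apply: tpow_eq => [||s].
- exact: lin_comp (@deconc_linear _ _) Gl.
- exact: lin_comp GGl (@deconc_linear _ _).
rewrite GE !deconc_pten /split_sum size_map (lin_sum GGl); apply: eq_bigr => i _.
by rewrite !stensE (tmap_tens Gl Gl) !GE map_take map_drop.
Qed.

Lemma antipode_tpmap x : antipode lam (tpmap g x) = tpmap g (antipode lam x).
Proof.
rewrite -!/(G _); move: x; apply: tpow_eq => [||s].
- exact: lin_comp (@antipode_linear _ _ _) Gl.
- exact: lin_comp Gl (@antipode_linear _ _ _).
have powE j r : conv_pow lam j (map g r) = G (conv_pow lam j r).
  elim: j r => [|j IH] r /=.
    by case: r => [|a r] /=; [rewrite GE|rewrite (lin0 Gl)].
  rewrite /split_sum size_map (lin_sum Gl); apply: eq_bigr => i _.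
  rewrite [RHS]tpmapM -map_drop -map_take; congr (qprod lam _ _); last exact: IH.
  by case: (take i r) => [|a r'] /=; [rewrite [RHS](lin0 Gl)|rewrite [RHS]GE].
rewrite GE !antipode_pten /anti_word size_map (lin_sum Gl).
by apply: eq_bigr => j _; rewrite powE (linZ Gl).
Qed.

Lemma twist_tpmap x : twist lam f (tpmap g x) = tpmap g (twist lam (f \o g) x).
Proof.
have fgl : scalar (f \o g) by move=> c a b /=; rewrite gl fl.
rewrite -!/(G _); move: x; apply: tpow_eq => [||s].
- exact: lin_comp (twist_linear lam fl) Gl.
- exact: lin_comp Gl (twist_linear lam fgl).
rewrite GE (twist_pten lam fl) (twist_pten lam fgl).
by case: s => [|a s] /=; rewrite ?(linD Gl) ?(linZ Gl) !GE.
Qed.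

Lemma untwist_tpmap x :
  untwist lam f (tpmap g x) = tpmap g (untwist lam (f \o g) x).
Proof.
have fgl : scalar (f \o g) by move=> c a b /=; rewrite gl fl.
by apply: (can_inj (twistK lam fl)); rewrite twist_tpmap !untwistK.
Qed.

Lemma range_tpmap_hopf_subalgebra :
  hopf_subalgebra (twisted_hopf lam fl) (range (tpmap g)).
Proof.
have fgl : scalar (f \o g) by move=> c a b /=; rewrite gl fl.
have fgM a b : (f \o g) (numul a b) = (f \o g) a * (f \o g) b.
  by rewrite /= gM fM.
apply: (@range_hopf_subalgebra _ _ _ _ (twisted_hopf lam fgl)).
- exact: Gl.
- by rewrite !twisted_oneE; exact: GE.
- move=> x y; rewrite (twisted_mulE lam fl fM) (twisted_mulE lam fgl fgM).
  exact: tpmapM.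
- move=> x; rewrite !twisted_comulE deconc_tpmap.
  have idl (C : comNuAlg k) : linear (@id (tpow C)) by [].
  have ul := untwist_linear lam fl; have ul' := untwist_linear lam fgl.
  rewrite (tmap_comp _ (idl _) Gl ul Gl) (tmap_comp _ Gl (idl _) Gl ul').
  have -> : untwist lam f \o tpmap g = tpmap g \o untwist lam (f \o g).
    by apply/funext => y; exact: untwist_tpmap.
  by have -> : id \o tpmap g = tpmap g \o id.
- move=> x; rewrite !twisted_antiE twist_tpmap antipode_tpmap untwist_tpmap.
  by [].
Qed.

End Functoriality.

(** * Products of Hopf subalgebras *)
Section Product.
Context {k : fieldType} {H : lmodType k}.
Variables (h : hopfAlg H) (U V : set H).
Hypotheses (mC : commutative (hpmul h))
  (SM : forall x y, hpanti h (hpmul h x y) = hpmul h (hpanti h x) (hpanti h y)).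
Hypotheses (hU : hopf_subalgebra h U) (hV : hopf_subalgebra h V).
Local Notation "x *_h y" := (hpmul h x y) (at level 40, left associativity).

Definition product_set : set H :=
  [set` Defs.span [set u *_h v | u in U & v in V]].

Let mb := hpmul_bilinear h.
Let ml y : linear (fun x => x *_h y). Proof. exact: mb.1. Qed.
Let mr x : linear (fun y => x *_h y). Proof. exact: mb.2. Qed.

Lemma product_setM u v : U u -> V v -> product_set (u *_h v).
Proof. by move=> Uu Vv; apply: Defs.mem_span; exists u => //; exists v. Qed.

Lemma product_set_ind (Q : H -> Prop) : Q 0 ->
  (forall c u v y, U u -> V v -> Q y -> Q (c *: (u *_h v) + y)) ->
  forall x, product_set x -> Q x.
Proof.
move=> Q0 QD; apply: Defs.span_ind => // c _ y [u Uu [v Vv <-]] Qy.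
exact: QD.
Qed.

Lemma product_set0 : product_set 0.
Proof. exact: rpred0. Qed.
Lemma product_setP c x y :
  product_set x -> product_set y -> product_set (c *: x + y).
Proof. by move=> Px Py; apply: rpredD => //; apply: rpredZ. Qed.

Lemma product_set_mul x y :
  product_set x -> product_set y -> product_set (x *_h y).
Proof.
move=> Px Py; move: x Px; apply: product_set_ind => [|c u v x Uu Vv Px].
  by rewrite (lin0 (ml y)); exact: product_set0.
rewrite (ml y); apply: product_setP => //; move: y Py {Px}.
apply: product_set_ind => [|d u' v' y Uu' Vv' Py].
  by rewrite (lin0 (mr _)); exact: product_set0.
rewrite (mr _); apply: product_setP => //.
have -> : u *_h v *_h (u' *_h v') = (u *_h u') *_h (v *_h v').
  by rewrite -!hpmulA [v *_h (u' *_h v')]hpmulA (mC v u') -(hpmulA h u').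
by apply: product_setM; [exact: hs_mul hU _ _ _ _|exact: hs_mul hV _ _ _ _].
Qed.

Lemma product_set_comul x :
  product_set x -> tensor_set product_set product_set (hpcomul h x).
Proof.
have Dl := hpcomul_linear h; have tb := tmul_bilinear mb mb.
move: x; apply: product_set_ind => [|c u v x Uu Vv Px].
  by rewrite (lin0 Dl); exact: rpred0.
rewrite Dl; apply: rpredD => //; apply: rpredZ; rewrite hpcomulM.
have DU := hs_comul hU Uu; have DV := hs_comul hV Vv.
move: (hpcomul h u) DU; apply: Defs.span_ind => [|d _ X [a Ua [b Ub <-]] PX].
  by rewrite (lin0 (tb.1 _)); exact: rpred0.
rewrite (tb.1 _); apply: rpredD => //; apply: rpredZ.
move: (hpcomul h v) DV {PX}; apply: Defs.span_ind => [|e _ Y [a' Va' [b' Vb' <-]] PY].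
  by rewrite (lin0 (tb.2 _)); exact: rpred0.
rewrite (tb.2 _); apply: rpredD => //; apply: rpredZ.
rewrite (tmul_tens mb mb); apply: Defs.mem_span.
by exists (a *_h a'); [exact: product_setM|exists (b *_h b'); [exact: product_setM|]].
Qed.

Lemma product_hopf_subalgebra : hopf_subalgebra h product_set.
Proof.
split.
- by rewrite -(hpmul1l h (hpone h)); apply: product_setM; apply: hs_one.
- exact: product_setP.
- exact: product_set_mul.
- exact: product_set_comul.
- have Sl := hpanti_linear h; apply: product_set_ind => [|c u v x Uu Vv Px].
    by rewrite (lin0 Sl); exact: product_set0.
  rewrite Sl; apply: product_setP => //; rewrite SM.
  by apply: product_setM; apply: hs_anti.
Qed.

Lemma product_setl u : U u -> product_set u.
Proof.
by move=> Uu; rewrite -(hpmul1r h u); apply: product_setM => //; exact: hs_one.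
Qed.

Lemma product_setr v : V v -> product_set v.
Proof.
by move=> Vv; rewrite -(hpmul1l h v); apply: product_setM => //; exact: hs_one.
Qed.

End Product.

(** The Hopf algebra [h] on [H] is seen inside the algebra [P] through the
    injective algebra morphism [j]. *)
Section Expand.
Context {k : fieldType} {H P : lmodType k}.
Variables (h : hopfAlg H) (U V : set H) (mul : P -> P -> P).
Variables (j : H -> P) (q : P -> H).
Hypotheses (mC : commutative (hpmul h))
  (SM : forall x y, hpanti h (hpmul h x y) = hpmul h (hpanti h x) (hpanti h y)).
Hypotheses (hU : hopf_subalgebra h U) (hV : hopf_subalgebra h V).
Hypotheses (jl : linear j) (ql : linear q) (jK : cancel j q).
Hypothesis jM : forall x y, mul (j x) (j y) = j (hpmul h x y).
Local Notation "x *_h y" := (hpmul h x y) (at level 40, left associativity).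
Local Notation W := (product_set h U V).
Local Notation A := (algprod mul (j @` U) (j @` V)).

Let mem_algprod x : W x ->
  j x \in Defs.span [set mul u v | u in j @` U & v in j @` V].
Proof.
move: x; apply: product_set_ind => [|c u v x Uu Vv Px].
  by rewrite (lin0 jl) rpred0.
rewrite jl; apply: rpredD => //; apply: rpredZ; apply: Defs.mem_span.
by exists (j u); [exists u|exists (j v); [exists v|exact: jM]].
Qed.

Let algprodP (x : A) : W (q (val x)) /\ j (q (val x)) = val x.
Proof.
suff aux y : y \in Defs.span [set mul u v | u in j @` U & v in j @` V] ->
    W (q y) /\ j (q y) = y by exact: aux (valP x).
move: y; apply: (@Defs.span_ind _ _ _ (fun y => W (q y) /\ j (q y) = y)).
  by rewrite (lin0 ql) (lin0 jl); split=> //; exact: product_set0.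
move=> c _ y [_ [u Uu <-] [_ [v Vv <-] <-]] [Wy Ey].
rewrite jM ql jK jl Ey; split=> //; apply: product_setP => //.
exact: product_setM.
Qed.

Lemma algprod_hopf_expandsI (lam : k) (e : nat -> H) (X : Type) (w : seq X -> H) :
  (forall n, U (e n)) -> (forall s, V (w s)) ->
  agko_structure h lam e -> deconcatenation_structure h w ->
  algprod_hopf_expands mul (j (hpone h)) (j @` U) (j @` V) lam
    (j \o e) (j \o w).
Proof.
move=> Ue Vw he hw.
have hW := product_hopf_subalgebra mC SM hU hV.
(* The structure on the product [A] is transported along the inclusion [i] of [A]
   into [H]; the projection onto [W] gives its left inverse [r]. *)
have [p [pl pW pK]] := exists_projection (product_set0 h U V) (hs_linear hW).
pose r z : A := exist _ (j (p z)) (mem_algprod (pW z)).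
pose i (x : A) := q (val x).
have vl : linear (val : A -> P) by move=> c x y; rewrite linearP.
have il : linear i by exact: lin_comp ql vl.
have rl : linear r.
  by move=> c x y; apply: val_inj; rewrite vl /= pl jl.
have Wi x : W (i x) := (algprodP x).1.
have ji x : j (i x) = val x := (algprodP x).2.
have ri : cancel i r by move=> x; apply: val_inj; rewrite /= pK.
have irE z : i (r z) = p z by rewrite /i /= jK.
have irK z : W z -> i (r z) = z by move=> Wz; rewrite irE pK.
have ir1 := irK _ (hs_one hW).
have irM x y : i (r (i x *_h i y)) = i x *_h i y.
  by apply: irK; apply: hs_mul hW _ _ _ _.
have irD x : tmap (i \o r) (i \o r) (hpcomul h (i x)) = hpcomul h (i x).
  have irl : linear (i \o r) by exact: lin_comp il rl.
  have := hs_comul hW (Wi x).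
  move: (hpcomul h _); apply: Defs.span_ind => [|c _ y [a Wa [b Wb <-]] Ey].
    exact: lin0 (tmap_linear irl irl).
  rewrite (tmap_linear irl irl) Ey (tmap_tens irl irl) /= (irK a Wa) (irK b Wb).
  by [].
have irS x : i (r (hpanti h (i x))) = hpanti h (i x).
  by apply: irK; apply: hs_anti hW _ _.
pose g := hopf_transport (h := h) il rl ri ir1 irM irD irS.
have gD x : hpcomul g x = tmap r r (hpcomul h (i x)) by [].
have gE x : hpcounit g x = hpcounit h (i x) by [].
have valr z : W z -> val (r z) = j z by move=> Wz; rewrite /= pK.
have sub (T : set H) : hopf_subalgebra h T -> T `<=` W ->
    j @` T `<=` range (val : A -> P) /\
    hopf_subalgebra g ((val : A -> P) @^-1` (j @` T)).
  move=> hT TW; have iT x : (j @` T) (val x) -> T (i x).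
    by rewrite -ji => -[t Tt E]; rewrite -(jK (i x)) -E jK.
  have rT z : T z -> (j @` T) (val (r z)).
    by move=> Tz; exists z => //; rewrite valr //; exact: TW.
  split=> [_ [t Tt <-]|]; first by exists (r t) => //; rewrite valr //; exact: TW.
  split.
  - exact: rT (hs_one hT).
  - move=> c x y /iT Tx /iT Ty; have /rT := hs_linear hT c Tx Ty.
    by rewrite rl !ri.
  - by move=> x y /iT Tx /iT Ty; apply: rT (hs_mul hT Tx Ty).
  - by move=> x /iT Tx; apply: (tmap_tensor_set rl _ (hs_comul hT Tx)).
  - by move=> x /iT Tx; apply: rT (hs_anti hT Tx).
have WU : U `<=` W by move=> u; exact: (product_setl hV).
have WV : V `<=` W by move=> v; exact: (product_setr hU).
have rrl := tmap_linear rl rl.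
exists g; split.
- split; last exact: valr (hs_one hW).
  move=> x y; rewrite -[val x]ji -[val y]ji jM.
  exact: valr (hs_mul hW (Wi x) (Wi y)).
- exact: sub.
- exact: sub.
- exists (fun n => r (e n)) => [n|]; first by rewrite valr //; exact: WU.
  split=> n; last by rewrite gE irK; [exact: he.2|exact: WU].
  rewrite gD irK; last exact: WU.
  rewrite he.1 (lin_sum rrl); apply: eq_bigr => a _.
  rewrite (lin_sum rrl); apply: eq_bigr => b _.
  by rewrite (linZ rrl) (tmap_tens rl rl).
- exists (fun s => r (w s)) => [s|]; first by rewrite valr //; exact: WV.
  split=> s; last by rewrite gE irK; [exact: hw.2|exact: WV].
  rewrite gD irK; last exact: WV.
  rewrite hw.1 (lin_sum rrl); apply: eq_bigr => a _.
  by rewrite (tmap_tens rl rl).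
Qed.

End Expand.

(** * The two Hopf structures *)

(** The ground field as an algebra, so that [gammap] is the map induced by the
    algebra morphism [scalarU]. *)
Definition scalar_alg (k : fieldType) : comNuAlg k.
Proof.
refine (@ComNuAlg k k^o (fun x y => x * y) _ _ _).
- split=> [z|z] c x y; first by rewrite mulrDl -scalerAl.
  by rewrite mulrDr -scalerAr.
- exact: (@mulrC k).
- exact: (@mulrA k).
Defined.

Theorem theorem3p3 (R : realType) (k : fieldType)
    (iota : {rmorphism k -> R[i]}) (X : hoffmanSet) (lam : k) :
  algprod_hopf_expands
    (shp (B := algU k X) lam) (pten [::])
    (range (@gammap k X)) (range (@inclp k X))
    lam (@unit_word k X) (fun w : seq X => inclp (letter_word k w))
  /\
  algprod_hopf_expands
    (shprod (B := algU k X) lam) (unitU k X \ox pten [::])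
    (range (@gamma k X)) (range (@incl k X))
    lam (fun n => unitU k X \ox unit_word k X n)
    (fun w : seq X => incl (letter_word k w)).
Proof.
pose B := algU k X; pose f (a : B) : k := a.1.
have fl : scalar f by move=> c [a u] [b v].
have fM a b : f (numul a b) = f a * f b by [].
pose h := twisted_hopf lam fl.
have hC : commutative (hpmul h).
  by move=> x y; rewrite /h !(twisted_mulE lam fl fM) qprodC.
have hSM x y : hpanti h (hpmul h x y) = hpmul h (hpanti h x) (hpanti h y).
  by rewrite /h !(twisted_mulE lam fl fM) twisted_antiM.
have mulE x y : hpmul h x y = shp lam x y.
  by rewrite /h (twisted_mulE lam fl fM) qprodE.
have oneE : hpone h = pten [::] by exact: twisted_oneE.
(* [gammap] and [inclp] are induced by the algebra morphisms [scalarU], [inclU]. *)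
have sM : forall a b : scalar_alg k,
    scalarU X (numul a b) = numul (scalarU X a) (scalarU X b).
  move=> a b; congr (_, _); rewrite /= !scaler0 !add0r.
  by rewrite (lin0 ((amul_bilinear k X).1 _)).
have iM (a b : algA k X) : inclU (numul a b) = numul (inclU a) (inclU b).
  by congr (_, _); rewrite /= ?mulr0 // !scale0r !add0r.
have hU : hopf_subalgebra h (range (@gammap k X)).
  exact: (@range_tpmap_hopf_subalgebra k B (scalar_alg k) lam (@scalarU k X) f
    (@scalarU_linear k X) sM fl fM).
have hV : hopf_subalgebra h (range (@inclp k X)).
  exact: (@range_tpmap_hopf_subalgebra k B (algA k X) lam (@inclU k X) f
    (@inclU_linear k X) iM fl fM).
have Ue n : range (@gammap k X) (unit_word k X n).
  by exists (pten (nseq n 1)) => //; exact: gammap_unit_word.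
have Vw (s : seq X) : range (@inclp k X) (inclp (letter_word k s)).
  by exists (letter_word k s).
have he : agko_structure h lam (@unit_word k X) by exact: twisted_agko.
have hw : deconcatenation_structure h (fun s : seq X => inclp (letter_word k s)).
  rewrite (_ : (fun s => _) = fun s : seq X =>
      pten [seq (inclU (of_letter k (Some x)) : B) | x <- s]).
    exact: twisted_deconcatenation.
  apply/funext => s; rewrite /inclp /letter_word tpmap_pten -?map_comp //.
  exact: inclU_linear.
split.
  have := algprod_hopf_expandsI (mul := shp (B := B) lam) (j := id) (q := id)
    hC hSM hU hV (@lin_id _ _) (@lin_id _ _) (fun=> erefl)
    (fun x y => esym (mulE x y)) Ue Vw he hw.
  by rewrite !image_id oneE.
(* For the second part, [f ⊗ id] is a left inverse of [x |-> 1_A ⊗ x]. *)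
pose j (x : tpow B) : Sh B := unitU k X \ox x.
have jl : linear j := tensr _.
have qb : is_bilinear (fun (a : B) (x : tpow B) => f a *: x).
  exact: (@scale_bilinearl k B (tpow B) f fl).
have jK : cancel j (tlift (fun (a : B) (x : tpow B) => f a *: x)).
  by move=> x; rewrite /j (tlift_tens qb) scale1r.
have jM x y : shprod lam (j x) (j y) = j (hpmul h x y).
  rewrite mulE; apply: etrans (tmul_tens (numul_bilinear B) (shp_bilinear B lam)
    _ _ _ _) _.
  exact: (congr1 (fun a : B => a \ox shp lam x y) (umul1 (unitU k X))).
have -> : range (@gamma k X) = j @` range (@gammap k X).
  have sl := @scalarU_linear k X.
  have gl : linear (@gammap k X) := @tpmap_linear k B (scalar_alg k) _ sl.
  have mb : is_bilinear (fun (c : k^o) (x : tpow k^o) => c *: x).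
    by apply: (@scale_bilinearl k k^o (tpow k^o) id).
  (* [gamma (c ⊗ x) = 1_A ⊗ gammap (c x)], as [c] may be moved across the tensor. *)
  have E t : gamma X t =
      j (gammap X (tlift (fun (c : k^o) (x : tpow k^o) => c *: x) t)).
    move: t; apply: tensor_eq => [||c x].
    - exact: tmap_linear sl gl.
    - exact: lin_comp jl (lin_comp gl (tlift_linear mb)).
    rewrite (tlift_tens mb) (linZ gl) (linZ jl).
    apply: etrans (tmap_tens sl gl c x) _.
    rewrite /j -(linZ (tensl _)); congr (_ \ox _).
    by congr (_, _); rewrite /= ?scaler0 // /GRing.scale /= mulr1.
  apply/seteqP; split=> [_ [t _ <-]|_ [_ [x _ <-] <-]].
    by rewrite E; eexists; [eexists|].
  by exists (1 \ox x); [|rewrite E (tlift_tens mb) scale1r].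
have -> : range (@incl k X) = j @` range (@inclp k X).
  apply/seteqP; split=> [_ [t _ <-]|_ [_ [x _ <-] <-]]; last by exists x.
  by exists (inclp t) => //; exists t.
have := algprod_hopf_expandsI (mul := shprod (B := B) lam) hC hSM hU hV jl
  (tlift_linear qb) jK jM Ue Vw he hw.
by rewrite oneE.
Qed.
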